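(* For every finite system $\mathcal E$ of equations between $\Sigma$-terms, the procedure $\mathsf{general\_aci}$ is correct and complete with respect to the general $ACI1$ theory: every substitution read off from the solved-form system $\mathcal E_s$ of a non-failing terminating branch of $\mathsf{general\_aci}(\mathcal E)$ is an $ACI1$-unifier of $\mathcal E$, and for every $ACI1$-unifier $\sigma$ of $\mathcal E$ some such branch yields a substitution more general than $\sigma$ modulo $ACI1$ on $\mathrm{vars}(\mathcal E)$.
   Context: $\Sigma$ contains the constant $\emptyset$, the binary symbol $\cup$, and free function symbols of arbitrary arities. $=_{ACI1}$ is the least congruence closed under substitution containing $(X\cup Y)\cup Z\approx X\cup(Y\cup Z)$, $X\cup Y\approx Y\cup X$, $X\cup X\approx X$, $X\cup\emptyset\approx X$. An $ACI1$-unifier of a system is a substitution $\sigma$ with $\ell\sigma=_{ACI1}r\sigma$ for each equation $\ell=r$. $\theta$ is more general than $\sigma$ on $W$ if there is $\lambda$ with $\sigma(X)=_{ACI1}\lambda(\theta(X))$ for all $X\in W$. A solved-form system $\{X_1=t_1,\dots,X_n=t_n\}$ (each $X_i$ occurring nowhere else) yields the substitution $[X_1/t_1,\dots,X_n/t_n]$. $\mathsf{general\_aci}(\mathcal E)$: $\mathcal E_s:=\emptyset$, $\mathcal E_{ns}:=\mathcal E$; while $\mathcal E_{ns}\ne\emptyset$, remove an arbitrary equation $e$ and act by cases: (1) $X=X$: nothing. (2) $t=X$, $t$ not a variable: add $X=t$. (3) $X=t$ where $t$ can be reordered as $f_1(\bar s_1)\cup\dots\cup f_n(\bar s_n)\cup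 V_1\cup\dots\cup V_m$ ($f_i\not\equiv\cup$, $V_j$ variables) with $X\in\mathrm{vars}(\bar s_1,\dots,\bar s_n)$: fail. (4) $X=t$, $X$ not in $t$: $\mathcal E_s:=\mathcal E_s[X/t]\wedge(X=t)$, $\mathcal E_{ns}:=\mathcal E_{ns}[X/t]$. (5) $X=t$ where $t$ reorders as $t'\cup X\cup\dots\cup X$ with $t'$ as in (3) and $X\notin\mathrm{vars}(t')$: add $X=t'\cup N$, $N$ new. (6) $f(\bar s)=g(\bar t)$, $f\not\equiv g$: fail. (7) $f(s_1,\dots,s_n)=f(t_1,\dots,t_n)$, $f\not\equiv\cup$: add $s_i=t_i$. (8) $s_1\cup s_2=t_1\cup t_2$: choose a result $\langle\mathcal E'_1,\mathcal E'_2,\theta\rangle$ of $\mathsf{aci\_step}$ on it; $\mathcal E_s:=\mathcal E_s\theta\wedge\mathcal E'_1$, $\mathcal E_{ns}:=\mathcal E_{ns}\theta\wedge\mathcal E'_2$. $\mathsf{aci\_step}$ on $f_1(\bar l_1)\cup\dots\cup f_{k_1}(\bar l_{k_1})\cup L_1\cup\dots\cup L_{k_2}=g_1(\bar r_1)\cup\dots\cup g_{h_1}(\bar r_{h_1})\cup R_1\cup\dots\cup R_{h_2}$ ($f_i,g_j\not\equiv\cup$, $L_i,R_j$ variables): (Normalization) introduce new variables $N^L_i$ for $f_i(\bar l_i)$ and $N^R_j$ for $g_j(\bar r_j)$; (Elementary $ACI1$ solution) compute the most general $ACI1$-unifier of the variable-only equation $N^L_1\cup\dots\cup N^L_{k_1}\cup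 L_1\cup\dots\cup L_{k_2}=N^R_1\cup\dots\cup N^R_{h_1}\cup R_1\cup\dots\cup R_{h_2}$, in which each variable $V$ is bound to a union of fresh variables $A_{\cdot,\cdot}$; let $\mathcal E^{ACI}_1$ be the bindings of the $L_i,R_j$ and $\mathcal E^{ACI}_2$ the bindings of the $N^L_i,N^R_j$ with these variables replaced by $f_i(\bar l_i)$, $g_j(\bar r_j)$; (Term propagation, non-deterministic) in a fixed order, for each $A$ occurring in a right-hand side of $\mathcal E^{ACI}_2$, with $f(\bar s)$ the left-hand side of the first equation containing it, set $\lambda(A)=\emptyset$ or $\lambda(A)=f(\bar s)$ and apply immediately; accept only if every equation becomes $f(\bar s)=f_1(\bar s_1)\cup\dots\cup f_h(\bar s_h)$ with $h\ge 1$ and all $f_i\equiv f$ (after removing $\emptyset$ and repetitions); let $\mathcal E_2$ consist of $\bar s=\bar s_1,\dots,\bar s=\bar s_h$ for each such equation, and $\mathcal E_1=\mathcal E^{ACI}_1\lambda$; (Variables removal) from $\mathcal E_1$ take the substitutions $\rho_X$ binding each $L_i,R_j$; with $X\Rightarrow Y$ iff $Y\in\mathrm{vars}(X\rho_X)$, fail if $X\Rightarrow^+X$ for some such $X$, else let $\rho$ be the composition of the $\rho_X$. Return $\langle\mathcal E_1,\mathcal E_2\rho,\rho\rangle$.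
   Formalization: Procedure corrected: cases (6),(7) exclude ∪, and case (8) takes all equations of non-variable terms with a union on some side; ∅ members are dropped in reorderings; aci_step returns E_1 with ρ applied to its right-hand sides. Otherwise X∪Y=a fails and E_s need not be in solved form. *)

(* Defs.v *)
From HB Require Import structures.
From mathcomp Require Import all_boot.
From Stdlib Require Import Relation_Operators.

Set Implicit Arguments.
Unset Strict Implicit.
Unset Printing Implicit Defensive.

(* [fsym] lists the free function symbols only; the constant for the empty set
   and the binary union are constructors of [term]. *)
Record signature := Signature { fsym :> eqType; arity : fsym -> nat }.

Inductive term (S : signature) : Type :=
| Var of nat
| Empty
| Union of term S & term S
| App (f : S) of {ffun 'I_(arity f) -> term S}.

Arguments Var {S} _.
Arguments Empty {S}.
Arguments Union {S} _ _.
Arguments App {S} f _.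

Section TermEq.
Variable S : signature.

Lemma term_ffun_ind (P : term S -> Prop) :
    (forall x, P (Var x)) -> P Empty ->
    (forall s t, P s -> P t -> P (Union s t)) ->
    (forall f (ts : {ffun 'I_(arity f) -> term S}),
        (forall i, P (ts i)) -> P (App f ts)) ->
  forall t, P t.
Proof.
move=> PV PE PU PA; fix IH 1; case=> [x||s t|f ts].
- exact: PV.
- exact: PE.
- exact: PU.
- by apply: PA => i; apply: IH.
Qed.

Fixpoint term_eqb (t u : term S) {struct t} : bool :=
  match t, u with
  | Var x, Var y => x == y
  | Empty, Empty => true
  | Union a b, Union c d => term_eqb a c && term_eqb b d
  | App f s, App g r =>
      match f =P g with
      | ReflectT e =>
          [forall i, term_eqb (s i) (r (cast_ord (congr1 (@arity S) e) i))]
      | ReflectF _ => false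
      end
  | _, _ => false
  end.

Lemma term_eqP : Equality.axiom term_eqb.
Proof.
move=> t u; apply: (iffP idP) => [|<-{u}].
  elim/term_ffun_ind: t u => [x||a b IHa IHb|f s IHs] [y||c d|g r] //=.
  - by move/eqP->.
  - by case/andP=> /IHa-> /IHb->.
  - case: eqP => // e; case: g / e r => r /forallP eq_sr.
    congr App; apply/ffunP=> i; rewrite (IHs _ _ (eq_sr i)).
    by congr (r _); apply: val_inj.
elim/term_ffun_ind: t => [x||a b IHa IHb|f s IHs] //=; first by rewrite IHa.
case: eqP => // e; apply/forallP=> i.
by rewrite (_ : cast_ord _ i = i) ?IHs //; apply: val_inj.
Qed.

HB.instance Definition _ := hasDecEq.Build (term S) term_eqP.

End TermEq.

Definition system (S : signature) := seq (term S * term S).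
Definition subst (S : signature) := nat -> term S.

Section Basics.
Variable S : signature.
Implicit Types (s t u : term S) (sigma theta : subst S) (E : system S).

Definition args t : seq (term S) :=
  if t is App f ts then [seq ts i | i <- enum 'I_(arity f)] else [::].

Definition head_sym t : option S := if t is App f _ then Some f else None.

Definition is_var t := if t is Var _ then true else false.
Definition is_union t := if t is Union _ _ then true else false.
Definition is_app t := if t is App _ _ then true else false.
Definition var_of t : option nat := if t is Var x then Some x else None.

Fixpoint vars t : seq nat :=
  match t with
  | Var x => [:: x]
  | Empty => [::]
  | Union s u => vars s ++ vars u
  | App f ts => flatten [seq vars (ts i) | i <- enum 'I_(arity f)]
  end.

Definition vars_sys E : seq nat := flatten [seq vars e.1 ++ vars e.2 | e <- E].

Fixpoint tsubst sigma t : term S :=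
  match t with
  | Var x => sigma x
  | Empty => Empty
  | Union s u => Union (tsubst sigma s) (tsubst sigma u)
  | App f ts => App f [ffun i => tsubst sigma (ts i)]
  end.

Definition subst_sys sigma E : system S :=
  [seq (tsubst sigma e.1, tsubst sigma e.2) | e <- E].

Definition subst1 (x : nat) t : subst S := fun y => if y == x then t else Var y.

(* Diagrammatic order: [sigma] is applied first. *)
Definition scomp sigma theta : subst S := fun x => tsubst theta (sigma x).

Inductive aci1 : term S -> term S -> Prop :=
| aci1_assoc x y z :
    aci1 (Union (Union (Var x) (Var y)) (Var z))
         (Union (Var x) (Union (Var y) (Var z)))
| aci1_comm x y : aci1 (Union (Var x) (Var y)) (Union (Var y) (Var x))
| aci1_idem x : aci1 (Union (Var x) (Var x)) (Var x)
| aci1_unit x : aci1 (Union (Var x) Empty) (Var x)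
| aci1_subst sigma s t :
    aci1 s t -> aci1 (tsubst sigma s) (tsubst sigma t)
| aci1_refl t : aci1 t t
| aci1_sym s t : aci1 s t -> aci1 t s
| aci1_trans s t u : aci1 s t -> aci1 t u -> aci1 s u
| aci1_union s s' t t' :
    aci1 s s' -> aci1 t t' -> aci1 (Union s t) (Union s' t')
| aci1_app (f : S) (ts us : {ffun 'I_(arity f) -> term S}) :
    (forall i, aci1 (ts i) (us i)) -> aci1 (App f ts) (App f us).

Definition unifier sigma E : Prop :=
  forall e, e \in E -> aci1 (tsubst sigma e.1) (tsubst sigma e.2).

Definition more_general (W : seq nat) theta sigma : Prop :=
  exists lambda : subst S,
    forall x, x \in W -> aci1 (sigma x) (tsubst lambda (theta x)).

Definition mgu theta E : Prop :=
  unifier theta E /\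
  forall sigma, unifier sigma E -> more_general (vars_sys E) theta sigma.

Definition solved_form E : Prop :=
  exists bs : seq (nat * term S),
    [/\ E = [seq (Var b.1, b.2) | b <- bs],
        uniq (unzip1 bs) &
        forall x b, x \in unzip1 bs -> b \in bs -> x \notin vars b.2].

Fixpoint subst_of E : subst S :=
  if E is e :: E' then
    fun y => if e.1 == Var y then e.2 else subst_of E' y
  else Var.

(* The union of no terms is [Empty]; no trailing [Empty] otherwise. *)
Fixpoint bigU (ts : seq (term S)) : term S :=
  match ts with
  | [::] => Empty
  | [:: t] => t
  | t :: ts' => Union t (bigU ts')
  end.

(* The reordering f1(..) U ... U fn(..) U V1 U ... U Vm of a term: its
   members, with occurrences of [Empty] dropped by the unit law. *)
Fixpoint members t : seq (term S) :=
  match t with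
  | Empty => [::]
  | Union s u => members s ++ members u
  | _ => [:: t]
  end.

Definition app_members t : seq (term S) := [seq u <- members t | is_app u].
Definition var_members t : seq nat := pmap var_of (members t).

End Basics.

Section AciStep.
Variable S : signature.
Implicit Types (l r : term S) (lam : subst S) (bind : nat -> seq nat).

Definition vunion (xs : seq nat) : term S := bigU [seq Var x | x <- xs].

(* Normalization and elementary solution: [NL], [NR] name the non-variable
   members of [l] and [r], and [bind x] lists the fresh variables whose union
   is the value at [x] of a most general unifier of the variable-only
   equation. *)
Record elementary_solution (used : seq nat) l r (NL NR : seq nat) bind : Prop :=
  ElementarySolution {
    es_sizeL : size NL = size (app_members l);
    es_sizeR : size NR = size (app_members r);
    es_uniq : uniq (NL ++ NR);
    es_new : forall x, x \in NL ++ NR -> x \notin used;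
    es_fresh : forall x a,
      x \in (NL ++ var_members l) ++ (NR ++ var_members r) -> a \in bind x ->
      a \notin used ++ NL ++ NR;
    es_mgu : mgu (fun x => vunion (bind x))
                 [:: (vunion (NL ++ var_members l),
                      vunion (NR ++ var_members r))]
  }.

Definition step_vars l r : seq nat := undup (var_members l ++ var_members r).

(* The bindings of the names, with each name replaced by the term it stands
   for and each right-hand side given as a list of variables. *)
Definition named_bindings l r (NL NR : seq nat) bind :
    seq (term S * seq nat) :=
  zip (app_members l ++ app_members r) [seq bind x | x <- NL ++ NR].

Definition propagation (E2 : seq (term S * seq nat)) lam : Prop :=
  forall a,
    match [seq p <- E2 | a \in p.2] with
    | [::] => lam a = Var a
    | p :: _ => lam a = Empty \/ lam a = p.1
    end.

Definition propagated lam (p : term S * seq nat) : seq (term S) :=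
  undup [seq u <- [seq lam a | a <- p.2] | u != Empty].

Definition accepted (E2 : seq (term S * seq nat)) lam : bool :=
  all (fun p => (0 < size (propagated lam p)) &&
                all (fun u => head_sym u == head_sym p.1) (propagated lam p)) E2.

Definition argument_system (E2 : seq (term S * seq nat)) lam : system S :=
  flatten [seq flatten [seq zip (args p.1) (args u) | u <- propagated lam p]
          | p <- E2].

Definition rhs bind lam (x : nat) : term S := tsubst lam (vunion (bind x)).

Definition depends l r bind lam (x y : nat) : bool :=
  (x \in step_vars l r) && (y \in vars (rhs bind lam x)).

Definition cyclic l r bind lam : Prop :=
  exists2 x, x \in step_vars l r &
             clos_trans nat (fun x y => depends l r bind lam x y) x x.

(* The substitutions binding single variables are composed in an order in
   which x precedes y whenever the value of x mentions y. *)
Definition removal_order l r bind lam (xs : seq nat) : Prop :=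
  perm_eq xs (step_vars l r) /\
  pairwise (fun x y => ~~ depends l r bind lam y x) xs.

Definition composition bind lam (xs : seq nat) : subst S :=
  foldl (fun rho x => scomp rho (subst1 x (rhs bind lam x))) Var xs.

(* A result consists of the variables introduced, the solved equations, the
   equations still to be solved and a substitution; [None] is failure. The
   composed substitution is applied to the right-hand sides of the solved
   equations: those may mention other variables of the step inside propagated
   terms, and would otherwise not be in solved form. *)
Variant aci_step (used : seq nat) l r :
    option (seq nat * system S * system S * subst S) -> Prop :=
| aci_reject NL NR bind lam :
    elementary_solution used l r NL NR bind ->
    propagation (named_bindings l r NL NR bind) lam ->
    ~~ accepted (named_bindings l r NL NR bind) lam ->
    aci_step used l r None
| aci_cyclic NL NR bind lam :
    elementary_solution used l r NL NR bind ->
    propagation (named_bindings l r NL NR bind) lam ->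
    accepted (named_bindings l r NL NR bind) lam ->
    cyclic l r bind lam ->
    aci_step used l r None
| aci_done NL NR bind lam xs :
    elementary_solution used l r NL NR bind ->
    propagation (named_bindings l r NL NR bind) lam ->
    accepted (named_bindings l r NL NR bind) lam ->
    ~ cyclic l r bind lam ->
    removal_order l r bind lam xs ->
    let rho := composition bind lam xs in
    aci_step used l r
      (Some ((NL ++ NR) ++
               flatten [seq bind x | x <- (NL ++ NR) ++ step_vars l r],
             [seq (Var x, tsubst rho (rhs bind lam x)) | x <- step_vars l r],
             subst_sys rho
               (argument_system (named_bindings l r NL NR bind) lam),
             rho)).

End AciStep.

(* [used] collects every variable that has ever occurred, so that new
   variables also avoid those no longer present in either system. *)
Record state (S : signature) := State {
  used : seq nat;
  solved : system S;
  todo : system S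
}.

Section GeneralAci.
Variable S : signature.
Implicit Types (s t l r : term S) (E Es : system S) (U : seq nat).

(* [act U Es E e o]: [E] is what is left of the unsolved equations once [e] has
   been removed, and [o] is the next state, [None] being failure. The clash and
   decomposition cases concern the free symbols and [Empty]; every equation
   between non-variable terms with a union on at least one side goes to
   [aci_step], a term that is not a union counting as a one-member union (or,
   for [Empty], as a union without members). *)
Variant act U Es E : term S * term S -> option (state S) -> Prop :=
| act_trivial x :
    act U Es E (Var x, Var x) (Some (State U Es E))
| act_orient t x :
    ~~ is_var t ->
    act U Es E (t, Var x) (Some (State U Es ((Var x, t) :: E)))
| act_occurs x t :
    x \in flatten [seq vars u | u <- app_members t] ->
    act U Es E (Var x, t) None
| act_eliminate x t :
    x \notin vars t ->
    act U Es E (Var x, t)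
      (Some (State U ((Var x, t) :: subst_sys (subst1 x t) Es)
                     (subst_sys (subst1 x t) E)))
| act_top_occurs x t n :
    ~~ is_var t ->
    x \in var_members t ->
    x \notin flatten [seq vars u | u <- app_members t] ->
    n \notin U ->
    act U Es E (Var x, t)
      (Some (State (n :: U) Es
         ((Var x, Union (bigU [seq u <- members t | u != Var x]) (Var n))
            :: E)))
| act_clash s t :
    ~~ is_var s -> ~~ is_var t -> ~~ is_union s -> ~~ is_union t ->
    head_sym s != head_sym t ->
    act U Es E (s, t) None
| act_decompose s t :
    ~~ is_var s -> ~~ is_var t -> ~~ is_union s -> ~~ is_union t ->
    head_sym s = head_sym t ->
    act U Es E (s, t) (Some (State U Es (zip (args s) (args t) ++ E)))
| act_union_fail l r :
    ~~ is_var l -> ~~ is_var r -> is_union l || is_union r ->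
    aci_step U l r None ->
    act U Es E (l, r) None
| act_union l r V E1 E2 theta :
    ~~ is_var l -> ~~ is_var r -> is_union l || is_union r ->
    aci_step U l r (Some (V, E1, E2, theta)) ->
    act U Es E (l, r)
      (Some (State (V ++ U) (subst_sys theta Es ++ E1)
                            (subst_sys theta E ++ E2))).

Variant step : state S -> option (state S) -> Prop :=
| step_select U Es E E' e o :
    act U Es (E ++ E') e o -> step (State U Es (E ++ e :: E')) o.

Inductive branch : state S -> system S -> Prop :=
| branch_done U Es : branch (State U Es [::]) Es
| branch_step st st' Es :
    step st (Some st') -> branch st' Es -> branch st Es.

Definition general_aci E Es : Prop := branch (State (vars_sys E) [::] E) Es.

End GeneralAci.

(* Main.v *)
From mathcomp Require Import all_boot.
From Stdlib Require Import Relation_Operators ClassicalEpsilon.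
Require Import Defs.

Set Implicit Arguments.
Unset Strict Implicit.
Unset Printing Implicit Defensive.

(** Correctness: no step adds a unifier. Along a branch, the left-hand sides of
the solved equations are distinct variables that occur nowhere else, so the
final system is solved and its substitution unifies it, hence unifies all
the previous systems.

Completeness: a unifier [sigma] of the current state, extended to the new
variables, selects a branch. In an ACI1 step, the mgu of the variable-only
equation factors [sigma] through some [lambda]; since the value of a name is a
single non-variable member, [lambda] sends each new variable bound to a name
either to the empty set or to that member, which dictates the propagation.
The depth of the value under [sigma] is invariant modulo ACI1 and decreases
strictly along the dependencies of the step, so there is no cycle and sorting
by depth gives a removal order. Arguments are less deep than the terms they
come from, so the multiset of the depths of the [sigma]-instances of the
unsolved equations decreases and the selected branch is finite. *)

(** * The semilattice of terms modulo ACI1 *)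

Section Semilattice.
Variable S : signature.
Implicit Types (s t u m : term S) (sigma tau : subst S) (ts : seq (term S)).

Lemma aci1_unionA s t u :
  aci1 (Union (Union s t) u) (Union s (Union t u)).
Proof. exact: (aci1_subst (nth Empty [:: s; t; u]) (aci1_assoc S 0 1 2)). Qed.

Lemma aci1_unionC s t : aci1 (Union s t) (Union t s).
Proof. exact: (aci1_subst (nth Empty [:: s; t]) (aci1_comm S 0 1)). Qed.

Lemma aci1_unionss s : aci1 (Union s s) s.
Proof. exact: (aci1_subst (nth Empty [:: s]) (aci1_idem S 0)). Qed.

Lemma aci1_unions0 s : aci1 (Union s Empty) s.
Proof. exact: (aci1_subst (nth Empty [:: s]) (aci1_unit S 0)). Qed.

(** The order of the join-semilattice of terms modulo ACI1, with [Union] as join and [Empty] as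
    least element. *)
Definition aci_le s t : Prop := aci1 (Union s t) t.

Lemma aci_le_refl s : aci_le s s.
Proof. exact: aci1_unionss. Qed.

Lemma aci_le_trans t s u : aci_le s t -> aci_le t u -> aci_le s u.
Proof.
rewrite /aci_le => st tu; apply: aci1_trans (tu).
apply: aci1_trans (aci1_union st (aci1_refl u)).
apply: aci1_trans (aci1_sym (aci1_unionA _ _ _)).
exact: aci1_union (aci1_refl s) (aci1_sym tu).
Qed.

Lemma aci_le_anti s t : aci_le s t -> aci_le t s -> aci1 s t.
Proof.
move=> st ts; apply: aci1_trans (aci1_sym ts) _.
exact: aci1_trans (aci1_unionC t s) st.
Qed.

Lemma aci1_le s t : aci1 s t -> aci_le s t.
Proof.
move=> st; apply: aci1_trans (aci1_unionss t).
exact: aci1_union st (aci1_refl t).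
Qed.

Lemma aci_leUl s t : aci_le s (Union s t).
Proof.
apply: aci1_trans (aci1_sym (aci1_unionA _ _ _)) _.
exact: aci1_union (aci1_unionss s) (aci1_refl t).
Qed.

Lemma aci_leUr s t : aci_le t (Union s t).
Proof. exact: aci_le_trans (aci_leUl t s) (aci1_le (aci1_unionC t s)). Qed.

Lemma aci_le0 t : aci_le Empty t.
Proof. exact: aci1_trans (aci1_unionC _ _) (aci1_unions0 t). Qed.

Lemma aci_leU s t u : aci_le (Union s t) u <-> aci_le s u /\ aci_le t u.
Proof.
split=> [stu|[su tu]].
  by split; apply: aci_le_trans stu; [apply: aci_leUl | apply: aci_leUr].
apply: aci1_trans (aci1_unionA _ _ _) _.
by apply: aci1_trans su; apply: aci1_union tu; apply: aci1_refl.
Qed.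

(** A term is determined modulo ACI1 by its upper bounds. Since the upper bounds of a union are the
    common upper bounds of its members, equations between unions become statements about sets of
    members, with no reordering by hand. *)
Lemma aci1_le_ext s t : (forall u, aci_le s u <-> aci_le t u) -> aci1 s t.
Proof.
move=> st; apply: aci_le_anti; first exact/st/aci_le_refl.
exact/(st s)/aci_le_refl.
Qed.

Lemma eq_aci_le s t u : aci1 s t -> aci_le s u <-> aci_le t u.
Proof.
move=> st; split; apply: aci_le_trans; apply: aci1_le => //.
exact: aci1_sym.
Qed.

Lemma tsubst_ext sigma tau t :
  (forall x, x \in vars t -> sigma x = tau x) -> tsubst sigma t = tsubst tau t.
Proof.
elim/term_ffun_ind: t => [x||s t IHs IHt|f ts IHts] //= st.
- by apply: st; rewrite inE.
- by rewrite IHs ?IHt // => x xs; apply: st; rewrite mem_cat xs ?orbT.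
- congr App; apply/ffunP=> i; rewrite !ffunE; apply: IHts => x xi.
  by apply: st; apply/flatten_mapP; exists i; rewrite ?mem_enum.
Qed.

Lemma tsubst_aci1 sigma tau t :
  (forall x, x \in vars t -> aci1 (sigma x) (tau x)) ->
  aci1 (tsubst sigma t) (tsubst tau t).
Proof.
elim/term_ffun_ind: t => [x||s t IHs IHt|f ts IHts] /= st.
- by apply: st; rewrite inE.
- exact: aci1_refl.
- by apply: aci1_union; [apply: IHs | apply: IHt] => x xs; apply: st;
    rewrite mem_cat xs ?orbT.
- apply: aci1_app => i; rewrite !ffunE; apply: IHts => x xi.
  by apply: st; apply/flatten_mapP; exists i; rewrite ?mem_enum.
Qed.

Lemma tsubst_Var t : tsubst Var t = t.
Proof.
elim/term_ffun_ind: t => [x||s t /= -> ->|f ts IHts] //=.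
by congr App; apply/ffunP=> i; rewrite ffunE.
Qed.

Lemma tsubst_id sigma t :
  (forall x, x \in vars t -> sigma x = Var x) -> tsubst sigma t = t.
Proof. by move/tsubst_ext->; rewrite tsubst_Var. Qed.

Lemma tsubst_scomp sigma tau t :
  tsubst tau (tsubst sigma t) = tsubst (scomp sigma tau) t.
Proof.
elim/term_ffun_ind: t => [x||s t /= -> ->|f ts IHts] //=.
by congr App; apply/ffunP=> i; rewrite !ffunE.
Qed.

Lemma vars_tsubst sigma t y :
  y \in vars (tsubst sigma t) -> exists2 x, x \in vars t & y \in vars (sigma x).
Proof.
elim/term_ffun_ind: t => [x||s t IHs IHt|f ts IHts] //=.
- by exists x; rewrite ?inE.
- rewrite mem_cat => /orP[/IHs|/IHt] [x xs yx]; exists x => //;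
    by rewrite mem_cat xs ?orbT.
- case/flatten_mapP=> i _; rewrite ffunE => /IHts[x xi yx]; exists x => //.
  by apply/flatten_mapP; exists i; rewrite ?mem_enum.
Qed.

Lemma le_tsubst_members sigma s t :
  aci_le (tsubst sigma s) t <->
  (forall u, u \in members s -> aci_le (tsubst sigma u) t).
Proof.
elim/term_ffun_ind: s => [x||s1 s2 IH1 IH2|f ts _].
- by split=> [le u|]; [rewrite inE => /eqP-> | apply; rewrite inE].
- by split=> // _; apply: aci_le0.
- rewrite /= aci_leU IH1 IH2; split=> [[le1 le2] u|le].
    by rewrite mem_cat => /orP[/le1|/le2].
  by split=> u us; apply: le; rewrite mem_cat us ?orbT.
- by split=> [le u|]; [rewrite inE => /eqP-> | apply; rewrite inE].
Qed.

Lemma le_members s t :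
  aci_le s t <-> (forall u, u \in members s -> aci_le u t).
Proof.
have:= le_tsubst_members Var s t; rewrite tsubst_Var => ->.
by split=> le u /le; rewrite tsubst_Var.
Qed.

Lemma mem_le s u : u \in members s -> aci_le u s.
Proof. by move: u; apply/le_members/aci_le_refl. Qed.

Lemma le_bigU sigma ts t :
  aci_le (tsubst sigma (bigU ts)) t <->
  (forall u, u \in ts -> aci_le (tsubst sigma u) t).
Proof.
elim: ts => [|s [|s' ts] IH]; first by split=> // _; apply: aci_le0.
  by split=> [le u|]; [rewrite inE => /eqP-> | apply; rewrite inE].
rewrite [bigU _]/= [tsubst _ _]/= aci_leU IH; split=> [[le1 le2] u|le].
  by rewrite inE => /predU1P[->|/le2].
by split=> [|u us]; apply: le; rewrite inE ?eqxx ?us ?orbT.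
Qed.

Lemma le_bigU_id ts t :
  aci_le (bigU ts) t <-> (forall u, u \in ts -> aci_le u t).
Proof.
have:= le_bigU Var ts t; rewrite tsubst_Var => ->.
by split=> le u /le; rewrite tsubst_Var.
Qed.

Lemma le_vunion sigma xs t :
  aci_le (tsubst sigma (vunion S xs)) t <->
  (forall x, x \in xs -> aci_le (sigma x) t).
Proof.
rewrite le_bigU; split=> [le x xs'|le u /mapP[x xs' ->]]; last exact: le.
exact: (le (Var x) (map_f _ xs')).
Qed.

Lemma mem_var_members s x : (x \in var_members s) = (Var x \in members s).
Proof.
rewrite /var_members; elim: (members s) => //= -[y||? ?|f ts] l IHl /=;
  by rewrite ?inE IHl //=; congr (_ || _).
Qed.

Lemma members_atom s u : u \in members s -> is_var u || is_app u.
Proof.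
elim/term_ffun_ind: s => [x||s1 s2 IH1 IH2|f ts _] //=.
- by rewrite inE => /eqP->.
- by rewrite mem_cat => /orP[/IH1|/IH2].
- by rewrite inE => /eqP->.
Qed.

Lemma le_tsubst_split sigma s t :
  aci_le (tsubst sigma s) t <->
  (forall u, u \in app_members s -> aci_le (tsubst sigma u) t) /\
  (forall x, x \in var_members s -> aci_le (sigma x) t).
Proof.
rewrite le_tsubst_members; split=> [le|[leA leV] u us].
  split=> [u|x]; first by rewrite mem_filter => /andP[_ /le].
  by rewrite mem_var_members => /le.
have:= members_atom us; case/orP=> uP.
  by case: u uP us => // x _ xs; apply: leV; rewrite mem_var_members.
by apply: leA; rewrite mem_filter uP.
Qed.

Lemma vars_members s x :
  x \in vars s <-> exists2 u, u \in members s & x \in vars u.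
Proof.
elim/term_ffun_ind: s => [y||s1 s2 IH1 IH2|f ts _].
- by split=> [xy|[u]]; [exists (Var y); rewrite ?mem_head | rewrite inE => /eqP->].
- by split=> // -[].
- rewrite /= mem_cat; split=> [/orP[/IH1|/IH2] [u us xu]|[u]].
  + by exists u; rewrite // mem_cat us.
  + by exists u; rewrite // mem_cat us orbT.
  rewrite mem_cat => /orP[us xu|us xu]; apply/orP; [left|right].
    by apply/IH1; exists u.
  by apply/IH2; exists u.
- by split=> [xf|[u]]; [exists (App f ts); rewrite ?mem_head | rewrite inE => /eqP->].
Qed.

Lemma vars_bigU ts x :
  x \in vars (bigU ts) -> exists2 u, u \in ts & x \in vars u.
Proof.
elim: ts => [|s [|s' ts] IH] //; first by exists s; rewrite ?inE.
rewrite [bigU _]/= [vars _]/= mem_cat => /orP[xs|/IH[u us xu]].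
  by exists s; rewrite ?inE ?eqxx.
by exists u; rewrite // inE us orbT.
Qed.

Lemma vars_vunion xs x : x \in vars (vunion S xs) = (x \in xs).
Proof.
apply/idP/idP => [/vars_bigU[u /mapP[y ys ->]]|xs'].
  by rewrite inE => /eqP->.
elim: xs xs' => [|y [|z xs] IH] //.
rewrite [vunion S _]/= -/(vunion S (z :: xs)) [vars _]/= !inE => /predU1P[->|/IH].
  by rewrite eqxx.
by move=> ->; rewrite orbT.
Qed.

(** * Inversion of ACI1 equality through members *)

Definition atom_eq m m' : Prop :=
  [/\ var_of m = var_of m', head_sym m = head_sym m' &
      forall i, aci1 (nth Empty (args m) i) (nth Empty (args m') i)].

(** Members are compared by [atom_eq], which looks only one level deep. It reads arguments by
    position with default [Empty], so that applications of two symbols known to be equal only by a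
    proof are compared without a cast. *)
Definition sub_members s t : Prop :=
  forall m, m \in members s -> exists2 m', m' \in members t & atom_eq m m'.

Lemma atom_eq_refl m : atom_eq m m.
Proof. by split=> // i; apply: aci1_refl. Qed.

Lemma atom_eq_trans m2 m1 m3 : atom_eq m1 m2 -> atom_eq m2 m3 -> atom_eq m1 m3.
Proof.
case=> v12 h12 a12 [v23 h23 a23]; split; rewrite ?v12 ?h12 // => i.
exact: aci1_trans (a12 i) (a23 i).
Qed.

Lemma sub_members_trans t s u :
  sub_members s t -> sub_members t u -> sub_members s u.
Proof.
move=> st tu m /st[m' /tu[m'' m''u e'] e]; exists m'' => //.
exact: atom_eq_trans e e'.
Qed.

Lemma members_tsubst sigma s m :
  m \in members (tsubst sigma s) <->
  exists2 u, u \in members s & m \in members (tsubst sigma u).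
Proof.
elim/term_ffun_ind: s => [x||s1 s2 IH1 IH2|f ts _].
- by split=> [mx|[u]]; [exists (Var x); rewrite ?mem_head | rewrite inE => /eqP->].
- by split=> // -[].
- rewrite /= mem_cat; split=> [/orP[/IH1|/IH2] [u us mu]|[u]].
  + by exists u; rewrite // mem_cat us.
  + by exists u; rewrite // mem_cat us orbT.
  rewrite mem_cat => /orP[us mu|us mu]; apply/orP; [left|right].
    by apply/IH1; exists u.
  by apply/IH2; exists u.
- by split=> [mf|[u]]; [exists (App f ts); rewrite ?mem_head | rewrite inE => /eqP->].
Qed.

Lemma nth_args (f : S) (ts : {ffun 'I_(arity f) -> term S}) (i : 'I_(arity f)) :
  nth Empty (args (App f ts)) i = ts i.
Proof. by rewrite (nth_map i) ?size_enum_ord // nth_ord_enum. Qed.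

Lemma nth_args_default (f : S) (ts : {ffun 'I_(arity f) -> term S}) i :
  arity f <= i -> nth Empty (args (App f ts)) i = Empty.
Proof. by move=> le_i; rewrite nth_default // size_map size_enum_ord. Qed.

Lemma nth_args_tsubst sigma m i : ~~ is_var m ->
  nth Empty (args (tsubst sigma m)) i = tsubst sigma (nth Empty (args m) i).
Proof.
case: m => [x||s t|f ts] // _; rewrite ?nth_nil //.
have [lt_i|ge_i] := ltnP i (arity f); last by rewrite !nth_args_default.
by rewrite !(nth_args _ (Ordinal lt_i)) ffunE.
Qed.

Lemma atom_eq_app (f : S) (ts us : {ffun 'I_(arity f) -> term S}) :
  (forall i, aci1 (ts i) (us i)) -> atom_eq (App f ts) (App f us).
Proof.
move=> tu; split=> // i; have [lt_i|ge_i] := ltnP i (arity f); last first.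
  by rewrite !nth_args_default //; apply: aci1_refl.
by rewrite !(nth_args _ (Ordinal lt_i)).
Qed.

(** A member of the instance of [s] comes from a member of [s]. A variable there is matched by the
    same variable in [t], an application by one with the same head and equal arguments; both
    relations survive instantiation. This is the substitution case of the next induction. *)
Lemma sub_members_tsubst sigma s t :
  sub_members s t -> sub_members (tsubst sigma s) (tsubst sigma t).
Proof.
move=> st m /members_tsubst[u us mu]; have [u' u't [uv uh ua]] := st _ us.
have:= members_atom us; have:= members_atom u't.
case: u uv uh ua us mu => [x||? ?|f ts]; case: u' u't => [y||? ?|g us] //=.
  move=> yt [->] _ _ _ mx _ _; exists m; last exact: atom_eq_refl.
  by apply/members_tsubst; exists (Var y).
move=> gt _ [efg] ua _; rewrite inE => /eqP-> _ _.
exists (tsubst sigma (App g us)).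
  by apply/members_tsubst; exists (App g us); rewrite ?inE.
split=> //=; first by rewrite efg.
move=> i; have:= aci1_subst sigma (ua i).
have ns := @nth_args_tsubst sigma (App _ _) i isT.
by rewrite -(ns f ts) -(ns g us).
Qed.

(** The axioms only regroup, permute or merge members or drop [Empty], and congruence under a free
    symbol changes arguments only within their classes. All later inversions (equal heads, equal
    arguments, no application equal to [Empty]) come from here. *)
Lemma aci1_sub_members s t : aci1 s t -> sub_members s t /\ sub_members t s.
Proof.
have sub_refl u : sub_members u u.
  by move=> m mu; exists m => //; apply: atom_eq_refl.
have same u v : members u =i members v -> sub_members u v /\ sub_members v u.
  by move=> uv; split=> m mu; exists m; rewrite ?uv // -?uv //;
    apply: atom_eq_refl.
elim=> {s t}.
- by move=> x y z; apply: same.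
- by move=> x y; apply: same => m; rewrite !inE orbC.
- by move=> x; apply: same => m; rewrite !inE orbb.
- by move=> x; apply: same.
- by move=> sigma s t _ [st ts]; split; apply: sub_members_tsubst.
- by move=> t; split.
- by move=> s t _ [].
- move=> s t u _ [st ts] _ [tu ut].
  by split; [apply: sub_members_trans st tu | apply: sub_members_trans ut ts].
- move=> s s' t t' _ [ss s's] _ [tt t't].
  split=> m; rewrite mem_cat => /orP[];
    [move/ss | move/tt | move/s's | move/t't];
    by case=> m' m's e; exists m'; rewrite // mem_cat m's ?orbT.
- move=> f ts us tu _; split=> m; rewrite inE => /eqP->.
    by exists (App f us); [rewrite inE | apply: atom_eq_app].
  exists (App f ts); first by rewrite inE.
  by apply: atom_eq_app => i; apply/aci1_sym/tu.
Qed.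

Lemma atom_eq_aci1 m m' :
  is_var m || is_app m -> is_var m' || is_app m' -> atom_eq m m' -> aci1 m m'.
Proof.
case: m => [x||? ?|f ts]; case: m' => [y||? ?|g us] // _ _ [] //.
  by case=> -> *; apply: aci1_refl.
move=> _ [efg]; subst g => eqa; apply: aci1_app => i.
by have:= eqa i; rewrite !nth_args.
Qed.

Lemma members_of_atom u : is_var u || is_app u -> members u = [:: u].
Proof. by case: u. Qed.

(** Variables and applications are join-prime: [aci_le m t] is an equation between [Union m t] and
    [t], and its left side has the member [m], which [t] must match. *)
Lemma atom_le_prime m t : is_var m || is_app m -> aci_le m t ->
  exists2 m', m' \in members t & aci1 m m'.
Proof.
move=> m_atom /aci1_sub_members[mt _].
have [|m' m't e] := mt m; first by rewrite /= members_of_atom ?inE ?eqxx.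
by exists m' => //; apply: atom_eq_aci1 => //; apply: members_atom m't.
Qed.

(** Any member of [s] lies below [u], hence equals [u] by primality, so [u] lies below [s] as soon
    as [s] has a member. This dichotomy is what makes the two choices of term propagation
    exhaustive. *)
Lemma le_atom s u : is_var u || is_app u -> aci_le s u ->
  members s = [::] \/ aci1 s u.
Proof.
move=> u_atom le_su; case Es: (members s) => [|m ms]; [by left | right].
have m_s : m \in members s by rewrite Es mem_head.
apply: aci_le_anti => //; apply: aci_le_trans (mem_le m_s).
have [] := @atom_le_prime m u; first exact: members_atom m_s.
  exact: aci_le_trans (mem_le m_s) le_su.
move=> m'; rewrite members_of_atom // inE => /eqP-> mu.
exact/aci1_le/aci1_sym.
Qed.

Lemma members0_aci1 s : members s = [::] -> aci1 s Empty.
Proof.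
move=> s0; apply: aci_le_anti; last exact: aci_le0.
by apply/le_members; rewrite s0.
Qed.

Lemma members_nonempty s u : is_var u || is_app u -> aci_le u s ->
  members s <> [::].
Proof. by move=> u_atom /(atom_le_prime u_atom)[m']; case: (members s). Qed.

Lemma app_aci1_heads s t : is_app s -> is_app t -> aci1 s t ->
  head_sym s = head_sym t.
Proof.
case: s => // f ts _; case: t => // g us _ /aci1_sub_members[st _].
by have [|m'] := st (App f ts); rewrite inE // => /eqP-> [].
Qed.

Lemma app_aci1_args (f : S) (ts us : {ffun 'I_(arity f) -> term S}) i :
  aci1 (App f ts) (App f us) -> aci1 (ts i) (us i).
Proof.
case/aci1_sub_members=> st _; have [|m'] := st (App f ts); first by rewrite inE.
by rewrite inE => /eqP-> [_ _ /(_ i)]; rewrite !nth_args.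
Qed.

(** * Depth, an invariant modulo ACI1 *)

Fixpoint depth (v : nat -> nat) t : nat :=
  match t with
  | Var x => v x
  | Empty => 0
  | Union s u => maxn (depth v s) (depth v u)
  | App f ts => (\max_(i < arity f) depth v (ts i)).+1
  end.

(** A substitution merely changes the valuation of the variables, which is why [depth] carries
    one. *)
Lemma depth_tsubst v sigma t :
  depth v (tsubst sigma t) = depth (fun x => depth v (sigma x)) t.
Proof.
elim/term_ffun_ind: t => [x||s t /= -> ->|f ts IHts] //=.
by congr _.+1; apply: eq_bigr => i _; rewrite ffunE.
Qed.

(* The valuation is universally quantified to get through [aci1_subst]. *)
Lemma depth_aci1 s t : aci1 s t -> forall v, depth v s = depth v t.
Proof.
elim=> {s t}.
- by move=> x y z v; rewrite /= maxnA.
- by move=> x y v; rewrite /= maxnC.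
- by move=> x v; rewrite /= maxnn.
- by move=> x v; rewrite /= maxn0.
- by move=> sigma s t _ IH v; rewrite !depth_tsubst IH.
- by [].
- by move=> s t _ IH v.
- by move=> s t u _ IH1 _ IH2 v; rewrite IH1.
- by move=> s s' t t' _ IH1 _ IH2 v; rewrite /= IH1 IH2.
- by move=> f ts us _ IH v /=; congr _.+1; apply: eq_bigr => i _.
Qed.

Lemma depth_le v s t : aci_le s t -> depth v s <= depth v t.
Proof. by move/depth_aci1/(_ v) <-; rewrite /= leq_maxl. Qed.

Lemma depth_arg v (f : S) (ts : {ffun 'I_(arity f) -> term S}) i :
  depth v (ts i) < depth v (App f ts).
Proof. by rewrite ltnS; apply: (leq_bigmax i). Qed.

Lemma depth_var v t x : x \in vars t -> v x <= depth v t.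
Proof.
elim/term_ffun_ind: t => [y||s t IHs IHt|f ts IHts].
- by rewrite inE => /eqP->.
- by [].
- by rewrite /= mem_cat leq_max => /orP[/IHs->|/IHt->]; rewrite ?orbT.
- case/flatten_mapP=> i _ /IHts; move/leq_trans; apply.
  exact/ltnW/depth_arg.
Qed.

Lemma depth_app_var v t x : is_app t -> x \in vars t -> v x < depth v t.
Proof.
case: t => // f ts _ /flatten_mapP[i _ /(depth_var v)].
by move/leq_ltn_trans; apply; apply: depth_arg.
Qed.

End Semilattice.

(** * Correctness *)

Section Correctness.
Variable S : signature.
Implicit Types (s t u l r : term S) (sigma tau theta : subst S).
Implicit Types (E Es : system S) (e : term S * term S) (U V xs : seq nat).

(** [tau] is an instance of [theta] with [tau] itself as the mediating substitution. Unifiers of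
    solved equations stand in this relation to the substitution that those equations define. *)
Definition absorbs tau theta : Prop :=
  forall x, aci1 (tsubst tau (theta x)) (tau x).

Lemma absorbs_tsubst tau theta t :
  absorbs tau theta -> aci1 (tsubst tau (tsubst theta t)) (tsubst tau t).
Proof. by move=> abs; rewrite tsubst_scomp; apply: tsubst_aci1 => x _; apply: abs. Qed.

Lemma absorbs_subst1 tau x t :
  aci1 (tau x) (tsubst tau t) -> absorbs tau (subst1 x t).
Proof.
move=> xt y; rewrite /subst1; case: eqP => [->|_]; first exact: aci1_sym.
exact: aci1_refl.
Qed.

Lemma unifier_cons tau e E :
  unifier tau (e :: E) <->
  aci1 (tsubst tau e.1) (tsubst tau e.2) /\ unifier tau E.
Proof.
split=> [un|[ue uE] e']; last by rewrite inE => /predU1P[->|/uE].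
by split=> [|e' e'E]; apply: un; rewrite inE ?eqxx ?e'E ?orbT.
Qed.

Lemma unifier_cat tau E E' :
  unifier tau (E ++ E') <-> unifier tau E /\ unifier tau E'.
Proof.
split=> [un|[uE uE'] e]; last by rewrite mem_cat => /orP[/uE|/uE'].
by split=> e eE; apply: un; rewrite mem_cat eE ?orbT.
Qed.

Lemma unifier_perm tau E E' :
  perm_eq E E' -> unifier tau E -> unifier tau E'.
Proof. by move=> /perm_mem eqE un e; rewrite -eqE => /un. Qed.

Lemma unifier_subst_sys tau theta E :
  absorbs tau theta -> unifier tau (subst_sys theta E) <-> unifier tau E.
Proof.
move=> abs; have abst t := absorbs_tsubst t abs.
split=> [un e eE|un _ /mapP[e eE ->]] /=.
  apply: aci1_trans (aci1_sym (abst _)) _; apply: aci1_trans (abst _).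
  exact: (un _ (map_f _ eE)).
apply: aci1_trans (abst _) _; apply: aci1_trans (aci1_sym (abst _)).
exact: un.
Qed.

Lemma vars_sys_cat E E' : vars_sys (E ++ E') = vars_sys E ++ vars_sys E'.
Proof. by rewrite /vars_sys map_cat flatten_cat. Qed.

Lemma vars_sys_perm E E' : perm_eq E E' -> vars_sys E =i vars_sys E'.
Proof.
by move=> /perm_mem eqE x; apply/flatten_mapP/flatten_mapP=> -[e eE xe];
  exists e; rewrite ?eqE // -eqE.
Qed.

Lemma vars_subst_sys theta E z :
  z \in vars_sys (subst_sys theta E) ->
  exists2 x, x \in vars_sys E & z \in vars (theta x).
Proof.
case/flatten_mapP=> _ /mapP[e eE ->] /=; rewrite mem_cat.
by case/orP=> /vars_tsubst[x xe zx]; exists x => //; apply/flatten_mapP;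
  exists e; rewrite // mem_cat xe ?orbT.
Qed.

Lemma mem_zip_pair (T1 T2 : eqType) (A : seq T1) (B : seq T2) p :
  p \in zip A B -> p.1 \in A /\ p.2 \in B.
Proof.
elim: A B => [|a A IH] [|b B] //=; rewrite !inE => /predU1P[->|/IH[-> ->]].
  by rewrite !eqxx.
by rewrite !orbT.
Qed.

Lemma vars_args t u x : u \in args t -> x \in vars u -> x \in vars t.
Proof.
case: t => // f ts /mapP[i _ ->] xi.
by apply/flatten_mapP; exists i; rewrite ?mem_enum.
Qed.

Lemma vars_zip_args s t x :
  x \in vars_sys (zip (args s) (args t)) -> x \in vars s ++ vars t.
Proof.
case/flatten_mapP=> e /mem_zip_pair[e1 e2].
by rewrite !mem_cat => /orP[/(vars_args e1)->|/(vars_args e2)->]; rewrite ?orbT.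
Qed.

Lemma zip_args (f : S) (ts us : {ffun 'I_(arity f) -> term S}) :
  zip (args (App f ts)) (args (App f us)) =
  [seq (ts i, us i) | i <- enum 'I_(arity f)].
Proof. exact: zip_map. Qed.

Lemma unifier_args tau s t : is_app s -> head_sym s = head_sym t ->
  unifier tau (zip (args s) (args t)) <-> aci1 (tsubst tau s) (tsubst tau t).
Proof.
case: s => // f ts _; case: t => [|| |g us] // -[efg]; subst g.
rewrite zip_args; split=> [un|eq_st _ /mapP[i _ ->]].
  apply: aci1_app => i; rewrite !ffunE.
  by apply: (un (ts i, us i)); apply: map_f; rewrite mem_enum.
by have:= app_aci1_args i eq_st; rewrite !ffunE.
Qed.

Lemma app_memberP t u :
  u \in app_members t -> is_app u /\ (forall x, x \in vars u -> x \in vars t).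
Proof.
rewrite mem_filter => /andP[u_app ut]; split=> // x xu.
by apply/vars_members; exists u.
Qed.

Lemma vars_var_members t x : x \in var_members t -> x \in vars t.
Proof.
rewrite mem_var_members => xt; apply/vars_members.
by exists (Var x); rewrite ?mem_head.
Qed.

(** * Composed substitutions along a removal order *)

Section Composition.
Variables (bind : nat -> seq nat) (lam : subst S).
Local Notation val := (rhs bind lam).
Local Notation comp := (composition bind lam).

(** The fold accumulates on the left; factoring out an arbitrary accumulator exposes the first
    variable and allows induction on [xs]. *)
Lemma composition_cons x xs y :
  comp (x :: xs) y = tsubst (comp xs) (subst1 x (val x) y).
Proof.
pose f (rho : subst S) x := scomp rho (subst1 x (val x)).
have fold zs rho z : foldl f rho zs z = tsubst (foldl f Var zs) (rho z).
  elim: zs rho z => [|z' zs IH] rho z /=; first by rewrite tsubst_Var.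
  rewrite IH tsubst_scomp; apply: tsubst_ext => w _.
  by rewrite IH.
by rewrite /composition /= fold.
Qed.

Definition triangular xs : Prop :=
  pairwise (fun x y => x \notin vars (val y)) xs /\
  forall x, x \in xs -> x \notin vars (val x).

Lemma triangular_cons x xs : triangular (x :: xs) ->
  (forall y, y \in x :: xs -> x \notin vars (val y)) /\ triangular xs.
Proof.
case=> /= /andP[/allP xr pw] irr; split; last first.
  by split=> // y yxs; apply: irr; rewrite inE yxs orbT.
by move=> y; rewrite inE => /predU1P[->|/xr//]; apply: irr; rewrite mem_head.
Qed.

Lemma composition_out xs y : y \notin xs -> comp xs y = Var y.
Proof.
elim: xs => // x xs IH; rewrite inE negb_or => /andP[yx yxs].
by rewrite composition_cons /subst1 (negbTE yx) /= IH.
Qed.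

(** The first variable of a triangular list occurs in none of the values, so its elimination leaves
    all of them unchanged and the rest of the list can be treated by induction. *)
Lemma composition_fix xs x : triangular xs -> x \in xs ->
  comp xs x = tsubst (comp xs) (val x).
Proof.
elim: xs x => // x0 xs IH x /triangular_cons[notin0 tri] xin.
have -> : tsubst (comp (x0 :: xs)) (val x) = tsubst (comp xs) (val x).
  apply: tsubst_ext => y yx; rewrite composition_cons /subst1 ifN //.
  by apply: contraNneq (notin0 x xin) => <-.
rewrite composition_cons /subst1; case: eqP => [->//|/eqP neq].
by rewrite /= IH //; move: xin; rewrite inE (negbTE neq).
Qed.

(** The value of a variable mentions only later variables of [xs], and these are replaced in their
    turn; hence no eliminated variable survives. *)
Lemma vars_composition xs y z : triangular xs -> z \in vars (comp xs y) ->
  z \notin xs /\ (z = y \/ exists2 x, x \in xs & z \in vars (val x)).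
Proof.
move=> tri; elim: xs tri y => [|x0 xs IH] /=.
  by move=> _ y; rewrite inE => /eqP->; split; last left.
move=> /triangular_cons[notin0 tri] y.
rewrite composition_cons => /vars_tsubst[w w_in /(IH tri)[zxs zw]].
have wP : w != x0 /\ (w = y \/ w \in vars (val x0)).
  move: w_in; rewrite /subst1; case: eqP => [_ wx0|/eqP neq].
    split; last by right.
    by apply: contraNneq (notin0 x0 (mem_head _ _)) => {1}<-.
  by rewrite inE => /eqP->; split=> //; left.
case: zw => [zw|[x xxs zx]].
  rewrite zw in zxs *; case: wP => w0 wP; split.
    by rewrite inE negb_or w0.
  by case: wP => [->|wx0]; [left | right; exists x0; rewrite ?mem_head].
have x_in : x \in x0 :: xs by rewrite inE xxs orbT.
split; last by right; exists x.
rewrite inE negb_or zxs andbT.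
by apply: contraNneq (notin0 x x_in) => <-.
Qed.

Lemma absorbs_composition tau xs :
  (forall x, x \in xs -> aci1 (tsubst tau (val x)) (tau x)) ->
  absorbs tau (comp xs).
Proof.
elim: xs => [|x xs IH] fix_xs y; first exact: aci1_refl.
rewrite composition_cons.
have {}IH: absorbs tau (comp xs).
  by apply: IH => z zxs; apply: fix_xs; rewrite inE zxs orbT.
apply: aci1_trans (absorbs_tsubst _ IH) _.
apply: absorbs_subst1; apply: aci1_sym; apply: fix_xs.
exact: mem_head.
Qed.

End Composition.

(** The order excludes that a value mentions an earlier variable, acyclicity that it mentions its
    own. *)
Lemma removal_order_triangular l r bind (lam : subst S) xs :
  ~ cyclic l r bind lam -> removal_order l r bind lam xs ->
  triangular bind lam xs.
Proof.
move=> acyc [/perm_mem eq_xs pw]; split; last first.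
  move=> x; rewrite eq_xs => x_in; apply/negP => xx; apply: acyc.
  by exists x => //; apply: t_step; rewrite /depends x_in.
apply: (sub_in_pairwise (P := mem xs)) pw; last exact/allP.
by move=> x y _ yxs; rewrite /depends -eq_xs (yxs : y \in xs).
Qed.

(** * Soundness of the elementary step *)

Lemma named_bindingP l r NL NR bind p :
  p \in named_bindings l r NL NR bind <->
  exists u x, (u, x) \in zip (app_members l ++ app_members r) (NL ++ NR) /\
              p = (u, bind x).
Proof.
rewrite /named_bindings; move: (_ ++ _) (_ ++ _) => N A.
have -> : zip A [seq bind x | x <- N] = [seq (q.1, bind q.2) | q <- zip A N].
  by elim: A N => [|a A IH] [|n N] //=; rewrite IH.
split=> [/mapP[[u x] ux ->]|[u [x [ux ->]]]]; first by exists u, x.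
by apply/mapP; exists (u, x).
Qed.

Lemma mem_zip_cat A1 A2 N1 N2 (u : term S) (x : nat) : size A1 = size N1 ->
  (u, x) \in zip (A1 ++ A2) (N1 ++ N2) =
  ((u, x) \in zip A1 N1) || ((u, x) \in zip A2 N2).
Proof. by move=> sz; rewrite zip_cat // mem_cat. Qed.

Lemma zip_lookup (A : seq (term S)) (N : seq nat) : size N = size A ->
  (forall u, u \in A -> exists x, (u, x) \in zip A N) /\
  (forall x, x \in N -> exists u, (u, x) \in zip A N).
Proof.
elim: A N => [|a A IH] [|n N] //= [/IH[IH1 IH2]]; split=> [u|x];
  rewrite inE => /predU1P[->|].
- by exists n; rewrite mem_head.
- by case/IH1=> x ux; exists x; rewrite inE ux orbT.
- by exists a; rewrite mem_head.
- by case/IH2=> u ux; exists u; rewrite inE ux orbT.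
Qed.

Lemma named_binding_app l r NL NR bind p :
  p \in named_bindings l r NL NR bind ->
  is_app p.1 /\ (forall x, x \in vars p.1 -> x \in vars l ++ vars r).
Proof.
case/mem_zip_pair; rewrite mem_cat => /orP[]/app_memberP[p_app pv] _;
  by split=> // x /pv; rewrite mem_cat => ->; rewrite ?orbT.
Qed.

(** Each member of [t] has the same value as the variable standing for it, and upper bounds are
    computed memberwise. Soundness uses this to undo normalization, completeness to perform it. *)
Lemma le_union_named tau delta N t u :
  size N = size (app_members t) ->
  (forall v x, (v, x) \in zip (app_members t) N ->
     aci1 (delta x) (tsubst tau v)) ->
  (forall x, x \in var_members t -> aci1 (delta x) (tau x)) ->
  aci_le (tsubst tau t) u <->
  aci_le (tsubst delta (vunion S (N ++ var_members t))) u.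
Proof.
move=> szN eqN eqV; have [look1 look2] := zip_lookup szN.
rewrite le_tsubst_split le_vunion; split=> [[leA leV] x|le].
  rewrite mem_cat => /orP[xN|xV]; last exact/(eq_aci_le _ (eqV x xV))/leV.
  have [v vx] := look2 x xN; have [/= vA _] := mem_zip_pair vx.
  exact/(eq_aci_le _ (eqN v x vx))/leA.
split=> [v /look1[x vx]|x xV].
  have [/= _ xN] := mem_zip_pair vx.
  by apply/(eq_aci_le _ (eqN v x vx))/le; rewrite mem_cat xN.
by apply/(eq_aci_le _ (eqV x xV))/le; rewrite mem_cat xV orbT.
Qed.

Lemma tsubst_vunion_comp tau bind (lam : subst S) xs :
  tsubst tau (tsubst lam (tsubst (fun x => vunion S (bind x)) (vunion S xs))) =
  tsubst (fun x => tsubst tau (rhs bind lam x)) (vunion S xs).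
Proof. by rewrite (tsubst_scomp _ lam) (tsubst_scomp _ tau). Qed.

Lemma le_rhs tau bind (lam : subst S) x u :
  aci_le (tsubst tau (rhs bind lam x)) u <->
  (forall a, a \in bind x -> aci_le (tsubst tau (lam a)) u).
Proof. by rewrite /rhs tsubst_scomp le_vunion. Qed.

Lemma mem_propagated (lam : subst S) p u :
  u \in propagated lam p ->
  u != Empty /\ exists2 a, a \in p.2 & u = lam a.
Proof.
by rewrite mem_undup mem_filter => /andP[-> /mapP[a ap ->]]; split; last exists a.
Qed.

Lemma propagated_mem (lam : subst S) p a :
  a \in p.2 -> lam a != Empty -> lam a \in propagated lam p.
Proof. by move=> ap a0; rewrite mem_undup mem_filter a0 map_f. Qed.

(** [delta] is an instance of the most general unifier, so it solves the variable-only equation. It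
    gives each step variable its value under [tau], and each name the value of the term it stands
    for; replacing names by terms then gives the equation between [l] and [r]. *)
Lemma aci_step_unifies tau U l r NL NR bind (lam : subst S) :
  elementary_solution U l r NL NR bind ->
  accepted (named_bindings l r NL NR bind) lam ->
  (forall x, x \in step_vars l r -> aci1 (tsubst tau (rhs bind lam x)) (tau x)) ->
  unifier tau (argument_system (named_bindings l r NL NR bind) lam) ->
  aci1 (tsubst tau l) (tsubst tau r).
Proof.
case=> szL szR _ _ _ [un _] acc fix_vars unA.
set E2 := named_bindings _ _ _ _ _ in acc unA.
pose delta x := tsubst tau (rhs bind lam x).
(* By acceptance the propagated terms have the head of [u], and the argument equations make each of
   them equal to [u]. That there is at least one keeps their union from being empty. *)
have eqN u x : (u, bind x) \in E2 -> aci1 (delta x) (tsubst tau u).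
  move=> uE2; have [u_app _] := named_binding_app uE2.
  have /andP[sz_gt0 /allP heads] := allP acc _ uE2.
  have eq_prop v : v \in propagated lam (u, bind x) ->
      aci1 (tsubst tau u) (tsubst tau v).
    move=> vp; apply/(unifier_args tau u_app).
      by rewrite (eqP (heads v vp)).
    move=> e ev; apply: unA; apply/flatten_mapP; exists (u, bind x) => //.
    by apply/flatten_mapP; exists v.
  apply: aci1_le_ext => t; rewrite le_rhs; split=> [le|le a ax].
    case Ep: (propagated lam (u, bind x)) sz_gt0 => [|v vs] // _.
    have vp : v \in propagated lam (u, bind x) by rewrite Ep mem_head.
    have [_ [a ax va]] := mem_propagated vp.
    by apply/(eq_aci_le _ (eq_prop v vp)); rewrite va; apply: le.
  have [->|a0] := eqVneq (lam a) Empty; first exact: aci_le0.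
  exact/(eq_aci_le _ (eq_prop _ (propagated_mem (p := (u, bind x)) ax a0))).
have:= un _ (mem_head _ _); move/(aci1_subst lam)/(aci1_subst tau).
rewrite !tsubst_vunion_comp => eq_lr.
apply: aci1_le_ext => t.
rewrite (le_union_named _ (delta := delta) szL); first last.
- by move=> x xl; apply: fix_vars; rewrite mem_undup mem_cat xl.
- move=> u x ux; apply: eqN; apply/named_bindingP; exists u, x.
  by rewrite mem_zip_cat // ux.
rewrite (eq_aci_le _ eq_lr).
rewrite (le_union_named _ (delta := delta) szR) //.
- move=> u x ux; apply: eqN; apply/named_bindingP; exists u, x.
  by rewrite mem_zip_cat // ux orbT.
- by move=> x xr; apply: fix_vars; rewrite mem_undup mem_cat xr orbT.
Qed.

(** * The invariant of the solved equations *)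

Record invariant U Es E : Prop := Invariant {
  inv_var : all (fun e => is_var e.1) Es;
  inv_uniq : uniq (unzip1 Es);
  inv_lhs : forall x, Var x \in unzip1 Es ->
    x \notin vars_sys E /\ (forall e, e \in Es -> x \notin vars e.2);
  inv_used : forall x, x \in vars_sys (Es ++ E) -> x \in U
}.

Lemma invariant_used U Es E x :
  invariant U Es E -> x \in vars_sys E -> x \in U.
Proof. by case=> _ _ _ us xE; apply: us; rewrite vars_sys_cat mem_cat xE orbT. Qed.

Lemma invariant_lhs_used U Es E x :
  invariant U Es E -> Var x \in unzip1 Es -> x \in U.
Proof.
case=> _ _ _ us /mapP[e eEs e1]; apply: us; rewrite vars_sys_cat mem_cat.
apply/orP; left; apply/flatten_mapP; exists e => //.
by rewrite -e1 mem_cat mem_head.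
Qed.

(** For the steps that leave the solved equations alone: new variables are outside [U], hence
    distinct from every solved left-hand side. *)
Lemma invariant_todo U V Es E E' :
  (forall x, x \in vars_sys E' -> x \in vars_sys E \/ x \in V /\ x \notin U) ->
  invariant U Es E -> invariant (V ++ U) Es E'.
Proof.
move=> subE inv; have [vE uq lhs us] := inv; split=> //.
- move=> x xl; have [xE xr] := lhs x xl; split=> //; apply/negP => /subE.
  by case=> [|[_]]; [apply/negP | rewrite (invariant_lhs_used inv xl)].
move=> x; rewrite vars_sys_cat !mem_cat => /orP[xEs|/subE[xE|[-> //]]].
  by rewrite us ?orbT // vars_sys_cat mem_cat xEs.
by rewrite us ?orbT // vars_sys_cat mem_cat xE orbT.
Qed.

(* The common shape of variable elimination and of [aci_step]: [xs] are the
   eliminated variables and [V] the new ones. *)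
Lemma invariant_eliminate U V Es E E2 e xs theta Es' :
    invariant U Es (e :: E) -> uniq xs ->
    (forall x, x \in xs -> x \in vars_sys [:: e]) ->
    (forall x, x \notin xs -> theta x = Var x) ->
    (forall x z, x \in xs -> z \in vars (theta x) ->
       z \notin xs /\ (z \in vars_sys [:: e] \/ z \in V /\ z \notin U)) ->
    (forall z, z \in vars_sys E2 ->
       z \notin xs /\ (z \in vars_sys [:: e] \/ z \in V /\ z \notin U)) ->
    perm_eq Es' (subst_sys theta Es ++ [seq (Var x, theta x) | x <- xs]) ->
  invariant (V ++ U) Es' (subst_sys theta E ++ E2).
Proof.
move=> inv uxs xs_e theta_out theta_in E2v pEs.
have [vE uq lhs us] := inv; have memEs := perm_mem pEs.
have eE x : (x \in vars_sys (e :: E)) =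
              (x \in vars_sys [:: e]) || (x \in vars_sys E).
  by rewrite -mem_cat -vars_sys_cat.
have theta_var x z : z \in vars (theta x) -> z \notin xs /\
    (z = x \/ z \in vars_sys [:: e] \/ z \in V /\ z \notin U).
  case: (boolP (x \in xs)) => [xin /(theta_in _ _ xin)[]|xout]; first by tauto.
  by rewrite theta_out // inE => /eqP->; tauto.
have lhs_xs x : Var x \in unzip1 Es -> x \notin xs.
  move=> /lhs[xE _]; apply: contra xE => /xs_e.
  by rewrite eE => ->.
have lhs_theta x : Var x \in unzip1 Es -> theta x = Var x.
  by move/lhs_xs/theta_out.
have e1_theta f : f \in Es -> tsubst theta f.1 = f.1.
  move=> fEs; have f1 := map_f fst fEs; have:= allP vE _ fEs.
  by case: (f.1) f1 => //= x /lhs_theta->.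
have fst_subst : unzip1 (subst_sys theta Es) = unzip1 Es.
  by rewrite /unzip1 -map_comp; apply/eq_in_map => f /e1_theta.
have fst_new : unzip1 [seq (Var x, theta x) | x <- xs] =
    [seq (Var x : term S) | x <- xs].
  by rewrite /unzip1 -map_comp; apply: eq_map.
have lhs_out x z : Var x \in unzip1 Es ->
    z \in vars_sys [:: e] \/ z \in V /\ z \notin U -> z != x.
  move=> xl zP; have xU := invariant_lhs_used inv xl; have [xE _] := lhs x xl.
  apply: contraTneq isT => zx; case: zP => [|[_]]; rewrite zx ?xU // => xe.
  by rewrite eE xe in xE.
have memlhs x : Var x \in unzip1 Es' -> Var x \in unzip1 Es \/ x \in xs.
  rewrite (perm_mem (perm_map fst pEs)) map_cat mem_cat -/unzip1 fst_subst.
  rewrite -/(unzip1 [seq (Var x : term S, theta x) | x <- xs]) fst_new.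
  by case/orP=> [|/mapP[y yxs [->]]]; [left | right].
split.
- rewrite (perm_all _ pEs) all_cat; apply/andP.
  split; apply/allP=> _ /mapP[f fEs ->] //=.
  by rewrite e1_theta // (allP vE).
- rewrite (perm_uniq (perm_map fst pEs)) map_cat -/unzip1.
  rewrite -/(unzip1 (subst_sys _ _)) fst_subst.
  rewrite -/(unzip1 [seq (Var x : term S, theta x) | x <- xs]) fst_new.
  rewrite cat_uniq uq map_inj_uniq ?uxs ?andbT //=; last by move=> x y [].
  by apply/hasPn=> _ /mapP[x xxs ->]; apply: contraL xxs => /lhs_xs.
- move=> x /memlhs xl.
  have x_theta y : y != x \/ x \in xs -> x \notin vars (theta y).
    move=> yx; apply/negP => /theta_var[xxs xP].
    case: xl => [xl|]; last by rewrite (negbTE xxs).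
    case: xP => [exy|/(lhs_out _ _ xl)]; last by rewrite eqxx.
    by case: yx; rewrite ?exy ?eqxx -?exy ?(negbTE xxs).
  (* An eliminated [x] cannot come out of [theta] at all. An older left-hand side [x] could only
     come out of [theta x], but it does not occur in the place [F] where [y] is found. *)
  have neq_or y (F : bool) : (Var x \in unzip1 Es -> ~~ F) ->
      (y = x -> F) -> y != x \/ x \in xs.
    case: xl => [xl nF|]; last by right.
    by move=> yF; left; apply/eqP => /yF; apply/negP/nF.
  split.
    rewrite vars_sys_cat mem_cat; apply/norP; split; last first.
      apply/negP => /E2v[xxs xP]; case: xl => [xl|]; last by rewrite (negbTE xxs).
      by have := lhs_out _ _ xl xP; rewrite eqxx.
    apply/negP => /vars_subst_sys[y yE]; apply/negP/x_theta.
    apply: (neq_or y (x \in vars_sys E)) => [|<- //].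
    by case/lhs=> + _; rewrite eE => /norP[].
  move=> f; rewrite memEs mem_cat => /orP[] /mapP[g gEs ->] /=; last first.
    apply/negP => xg; have [xxs xP] := theta_in _ _ gEs xg.
    case: xl => [xl|]; last by rewrite (negbTE xxs).
    by have := lhs_out _ _ xl xP; rewrite eqxx.
  apply/negP => /vars_tsubst[y yg]; apply/negP/x_theta.
  apply: (neq_or y (x \in vars g.2)) => [|<- //].
  by case/lhs=> _; apply.
- have used_e z : z \in vars_sys [:: e] \/ z \in V /\ z \notin U -> z \in V ++ U.
    move=> zP; rewrite mem_cat; case: zP => [ze|[-> //]].
    rewrite us ?orbT //.
    by rewrite vars_sys_cat mem_cat eE ze !orbT.
  have used_theta y z : y \in U -> z \in vars (theta y) -> z \in V ++ U.
    by move=> yU /theta_var[_ [->|/used_e//]]; rewrite mem_cat yU orbT.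
  move=> z; rewrite !vars_sys_cat mem_cat (vars_sys_perm pEs).
  rewrite vars_sys_cat !mem_cat -!orbA.
  rewrite -[(z \in V) || _]mem_cat; case/or4P.
  + move/vars_subst_sys=> [y yEs]; apply: used_theta; apply: us.
    by rewrite vars_sys_cat mem_cat yEs.
  + case/flatten_mapP=> _ /mapP[x xxs ->]; rewrite in_cons.
    case/predU1P=> [->|/theta_in[]// _ /used_e//].
    by apply: used_e; left; apply: xs_e.
  + move/vars_subst_sys=> [y yEs]; apply: used_theta; apply: us.
    by rewrite vars_sys_cat mem_cat eE yEs !orbT.
  + by case/E2v=> _ /used_e.
Qed.

Lemma vars_sys_cons x e E :
  (x \in vars_sys (e :: E)) = (x \in vars e.1 ++ vars e.2) || (x \in vars_sys E).
Proof. by rewrite /vars_sys /= mem_cat. Qed.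

Lemma vars_sys1 x e : (x \in vars_sys [:: e]) = (x \in vars e.1 ++ vars e.2).
Proof. by rewrite vars_sys_cons orbF. Qed.

Lemma propagationP l r NL NR bind (lam : subst S) a :
    propagation (named_bindings l r NL NR bind) lam ->
  [\/ lam a = Var a /\
        (forall p, p \in named_bindings l r NL NR bind -> a \notin p.2),
      lam a = Empty |
      exists p, [/\ p \in named_bindings l r NL NR bind, a \in p.2 & lam a = p.1]].
Proof.
move/(_ a); case Ef: [seq p <- _ | _] => [|p ps].
  move=> lam_a; constructor 1; split=> // p pE; apply/negP => ap.
  by have: p \in [seq p <- named_bindings l r NL NR bind | a \in p.2];
    [rewrite mem_filter ap | rewrite Ef].
case=> lam_a; [by constructor 2 | constructor 3; exists p].
have: p \in [seq p <- named_bindings l r NL NR bind | a \in p.2].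
  by rewrite Ef mem_head.
by rewrite mem_filter => /andP[].
Qed.

Lemma vars_rhs l r NL NR bind (lam : subst S) y z :
    propagation (named_bindings l r NL NR bind) lam ->
    z \in vars (rhs bind lam y) ->
  z \in vars l ++ vars r \/ z \in bind y.
Proof.
move=> prop /vars_tsubst[a]; rewrite vars_vunion => ay.
case: (propagationP a prop) => [[-> _]|->|[p [pE _ ->]]] //.
  by rewrite inE => /eqP->; right.
by have [_ pv] := named_binding_app pE; left; apply: pv.
Qed.

Lemma vars_argument_system l r NL NR bind (lam : subst S) z :
    propagation (named_bindings l r NL NR bind) lam ->
    z \in vars_sys (argument_system (named_bindings l r NL NR bind) lam) ->
  z \in vars l ++ vars r.
Proof.
move=> prop /flatten_mapP[e /flatten_mapP[p pE /flatten_mapP[u up eu]] ze].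
have [_ pv] := named_binding_app pE.
have: z \in vars p.1 ++ vars u.
  by apply: vars_zip_args; apply/flatten_mapP; exists e.
rewrite mem_cat => /orP[/pv//|]; have [_ [a ap ->]] := mem_propagated up.
case: (propagationP a prop) => [[_ /(_ p pE)]|->|[q [qE _ ->]]] //.
  by rewrite ap.
by have [_ qv] := named_binding_app qE; apply: qv.
Qed.

Lemma mem_step_vars l r x :
  (x \in step_vars l r) = (x \in var_members l) || (x \in var_members r).
Proof. by rewrite mem_undup mem_cat. Qed.

Lemma vars_step_vars l r x : x \in step_vars l r -> x \in vars l ++ vars r.
Proof.
by rewrite mem_step_vars mem_cat => /orP[]/vars_var_members->; rewrite ?orbT.
Qed.

(** By [composition_fix] the solved equations bind each step variable to its value under [rho], so
    the step is an elimination covered by [invariant_eliminate]. A unifier of these equations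
    absorbs [rho], which brings all substituted systems back to the original ones. *)
Lemma aci_step_sound U Es E l r V E1 E2 rho :
    aci_step U l r (Some (V, E1, E2, rho)) ->
    invariant U Es ((l, r) :: E) ->
  invariant (V ++ U) (subst_sys rho Es ++ E1) (subst_sys rho E ++ E2) /\
  (forall tau, unifier tau (subst_sys rho Es ++ E1) ->
     unifier tau (subst_sys rho E ++ E2) ->
     unifier tau Es /\ unifier tau ((l, r) :: E)).
Proof.
move Eo: (Some _) => o step; case: step Eo => //.
move=> NL NR bind lam xs es prop acc acyc ord {}rho' [-> -> -> ->] inv {V E1 E2 rho}.
have tri := removal_order_triangular acyc ord.
case: ord => pxs _; have mem_xs := perm_mem pxs.
set rho := rho'; set E2 := named_bindings _ _ _ _ _ in prop acc *.
have rho_fix x : x \in step_vars l r -> tsubst rho (rhs bind lam x) = rho x.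
  by move=> x_in; rewrite [RHS]composition_fix ?mem_xs.
have -> : [seq (Var x : term S, tsubst rho (rhs bind lam x))
              | x <- step_vars l r] =
          [seq (Var x : term S, rho x) | x <- step_vars l r].
  by apply/eq_in_map => x /rho_fix->.
split.
  have fresh_val y z : y \in step_vars l r -> z \in vars (rhs bind lam y) ->
      z \in vars_sys [:: (l, r)] \/
      z \in (NL ++ NR) ++ flatten [seq bind x | x <- (NL ++ NR) ++ step_vars l r]
      /\ z \notin U.
    rewrite vars_sys1 => y_in /(vars_rhs prop)[|zy]; [by left | right; split].
      rewrite mem_cat; apply/orP; right; apply/flatten_mapP; exists y => //.
      by rewrite mem_cat y_in orbT.
    have: z \notin U ++ NL ++ NR.
      apply: (es_fresh es) zy; move: y_in.
      by rewrite mem_step_vars !mem_cat => /orP[]->; rewrite !orbT.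
    by rewrite mem_cat => /norP[].
  apply: (invariant_eliminate (xs := step_vars l r) inv).
  - exact: undup_uniq.
  - by move=> x /vars_step_vars; rewrite vars_sys1.
  - by move=> x x_out; apply: composition_out; rewrite mem_xs.
  - move=> x z x_in /(vars_composition tri); rewrite mem_xs => -[z_out [zx|]].
      by rewrite zx x_in in z_out.
    case=> y; rewrite mem_xs => y_in zy; split=> //.
    exact: (fresh_val y).
  - move=> z /vars_subst_sys[y yA /(vars_composition tri)].
    rewrite mem_xs => -[z_out zP]; split=> //; case: zP => [->|[x]].
      by left; rewrite vars_sys1; apply: vars_argument_system yA.
    by rewrite mem_xs => x_in; apply: fresh_val.
  - exact: perm_refl.
move=> tau /unifier_cat[unEs un1] /unifier_cat[unE unA].
have fix_tau x : x \in step_vars l r -> aci1 (tau x) (tsubst tau (rho x)).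
  by move=> x_in; apply: (un1 (Var x, rho x)); apply: map_f.
have abs : absorbs tau rho.
  move=> x; have [x_in|x_out] := boolP (x \in step_vars l r).
    exact/aci1_sym/fix_tau.
  by rewrite [rho x]composition_out ?mem_xs //; apply: aci1_refl.
have {}unEs := (unifier_subst_sys Es abs).1 unEs.
have {}unE := (unifier_subst_sys E abs).1 unE.
have {}unA := (unifier_subst_sys _ abs).1 unA.
split=> //; apply/unifier_cons; split=> //.
apply: (aci_step_unifies es acc) unA => x x_in.
apply: aci1_trans (aci1_sym (absorbs_tsubst _ abs)) _.
by rewrite rho_fix //; apply: abs.
Qed.

Lemma act_sound U Es E e st :
    act U Es E e (Some st) -> invariant U Es (e :: E) ->
  invariant (used st) (solved st) (todo st) /\
  (forall tau, unifier tau (solved st) -> unifier tau (todo st) ->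
     unifier tau Es /\ unifier tau (e :: E)).
Proof.
move Eo: (Some _) => o step; case: step Eo => //.
- move=> x [->] inv; split=> [|tau unEs unE] /=.
    apply: (@invariant_todo _ [::]) inv => y yE.
    by left; rewrite vars_sys_cons yE orbT.
  by split=> //; apply/unifier_cons; split=> //; apply: aci1_refl.
- move=> t x _ [->] inv; split=> [|tau /= unEs /unifier_cons[un1 unE]] /=.
    apply: (@invariant_todo _ [::]) inv => y yE.
    by left; move: yE; rewrite !vars_sys_cons !mem_cat (orbC (y \in vars t)).
  by split=> //; apply/unifier_cons; split=> //; apply: aci1_sym.
- move=> x t xt [->] inv; split=> [|tau /= /unifier_cons[un1 unEs] unE] /=.
    have tx : subst1 x t x = t by rewrite /subst1 eqxx.
    (* Elimination of the single variable [x], with no new variable and no new equation. *)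
    rewrite -[subst_sys _ E]cats0; apply: (@invariant_eliminate _ [::]) inv _ _ _ _ _ _.
    + exact: (isT : uniq [:: x]).
    + by move=> y; rewrite inE => /eqP->; rewrite vars_sys1 mem_cat mem_head.
    + by move=> y; rewrite inE /subst1 => /negbTE->.
    + move=> y z; rewrite inE => /eqP->; rewrite tx => zt.
      split; last by left; rewrite vars_sys1 mem_cat zt orbT.
      by rewrite inE; apply: contraNneq xt => <-.
    + by [].
    + by rewrite /= tx cats1 -perm_rcons.
  have abs := absorbs_subst1 un1.
  have {}unEs := (unifier_subst_sys Es abs).1 unEs.
  have {}unE := (unifier_subst_sys E abs).1 unE.
  by split=> //; apply/unifier_cons.
- move=> x t n _ xt _ nU [->] inv.
  have mem_bigU y : y \in vars (bigU [seq u <- members t | u != Var x]) ->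
      y \in vars t.
    case/vars_bigU=> u; rewrite mem_filter => /andP[_ ut] yu.
    by apply/vars_members; exists u.
  split=> [|tau /= unEs /unifier_cons[/= un1 unE]] /=.
    apply: (@invariant_todo _ [:: n]) inv => y.
    rewrite !vars_sys_cons !inE mem_cat inE => /orP[/or3P[->|/mem_bigU->|]|->].
    + by left.
    + by left; rewrite orbT.
    + by move/eqP->; right; rewrite eqxx.
    + by left; rewrite orbT.
  split=> //; apply/unifier_cons; split=> //=.
  (* The new equation puts every other member of [t] below [x]; since [x] is itself a member of [t],
     the two become equal. *)
  have le_x u : u \in members t -> u != Var x -> aci_le (tsubst tau u) (tau x).
    move=> ut ux; apply: aci_le_trans (aci1_le (aci1_sym un1)).
    apply: aci_le_trans (aci_leUl _ _).
    have/le_bigU := aci_le_refl (tsubst tau (bigU [seq u <- members t | u != Var x])).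
    by apply; rewrite mem_filter ux.
  apply: aci_le_anti; last first.
    apply/le_tsubst_members => u ut; have [->|] := eqVneq u (Var x).
      exact: aci_le_refl.
    exact: le_x.
  have /le_tsubst_members le_t := aci_le_refl (tsubst tau t).
  by apply: (le_t (Var x)); rewrite -mem_var_members.
- move=> s t sV tV sU tU hst [->] inv.
  split=> [|tau /= unEs /unifier_cat[unA unE]] /=.
    apply: (@invariant_todo _ [::]) inv => y.
    rewrite vars_sys_cat mem_cat vars_sys_cons.
    by case/orP=> [/vars_zip_args->|->]; left; rewrite ?orbT.
  split=> //; apply/unifier_cons; split=> //=.
  have [s_app|s_napp] := boolP (is_app s); first exact/unifier_args.
  (* Without head symbol both sides are [Empty]. *)
  case: s sV sU hst s_napp {unA inv} => // _ _.
  case: t tV tU => // _ _ _ _; exact: aci1_refl.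
- move=> l r V E1 E2 theta _ _ _ step [->] inv.
  exact: aci_step_sound step inv.
Qed.

Lemma invariant_perm U Es E E' :
  perm_eq E E' -> invariant U Es E -> invariant U Es E'.
Proof.
move=> pE; apply: (@invariant_todo _ [::]) => x.
by rewrite (vars_sys_perm pE); left.
Qed.

(** * Reading off the substitution *)

Lemma subst_of_out Es x : Var x \notin unzip1 Es -> subst_of Es x = Var x.
Proof. by elim: Es => //= e Es IH /norP[+ /IH->]; rewrite eq_sym => /negbTE->. Qed.

Lemma subst_of_in Es x t :
  uniq (unzip1 Es) -> (Var x, t) \in Es -> subst_of Es x = t.
Proof.
elim: Es => //= e Es IH /andP[e_out uq]; rewrite inE => /predU1P[<-|xt] /=.
  by rewrite eqxx.
rewrite ifN ?IH //; apply: contra e_out => /eqP->.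
exact: (map_f fst xt).
Qed.

(** Right-hand sides contain no solved variable, so the substitution leaves them unchanged. *)
Lemma invariant_unifier U Es E : invariant U Es E -> unifier (subst_of Es) Es.
Proof.
case=> vE uq lhs _ [s t] eEs /=.
have := allP vE _ eEs; case: s eEs => // x eEs _ /=.
rewrite (subst_of_in uq eEs) tsubst_id; first exact: aci1_refl.
move=> y yt; apply: subst_of_out; apply: contraL yt => /lhs[_].
by move/(_ _ eEs).
Qed.

Lemma invariant_solved_form U Es E : invariant U Es E -> solved_form Es.
Proof.
(* The default 0 is never reached, since all left-hand sides are variables. *)
case=> vE uq lhs _; pose idx (s : term S) := odflt 0 (var_of s).
have idxK e : e \in Es -> Var (idx e.1) = e.1 by move/(allP vE); case: e.1.
exists [seq (idx e.1, e.2) | e <- Es].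
have fst_idx : [seq Var i | i <- unzip1 [seq (idx e.1, e.2) | e <- Es]] = unzip1 Es.
  by rewrite /unzip1 -!map_comp; apply/eq_in_map => e /idxK.
split.
- by rewrite -map_comp -[LHS]map_id; apply/eq_in_map => -[s t] /idxK /= ->.
- by apply: (@map_uniq _ _ (@Var S)); rewrite fst_idx.
- move=> x _ x_in /mapP[e eEs ->]; have [] := lhs x; last by move=> _; apply.
  by rewrite -fst_idx map_f.
Qed.

Lemma branch_sound st Es : branch st Es ->
    invariant (used st) (solved st) (todo st) ->
  (exists U, invariant U Es [::]) /\
  (forall tau, unifier tau Es -> unifier tau (solved st) /\ unifier tau (todo st)).
Proof.
elim=> {st Es} [U Es inv|st st' Es step _ IH].
  by split=> [|tau]; [exists U | split].
move Eo: (Some st') step => o step.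
case: step Eo => U Es' E E' e {}o step eo; rewrite -{}eo in step => inv.
have pE : perm_eq (E ++ e :: E') (e :: E ++ E') by rewrite -cat1s perm_catCA.
have [inv' un'] := act_sound step (invariant_perm pE inv).
have [ex un] := IH inv'; split=> // tau /un[un1 un2].
have [unEs unE] := un' tau un1 un2; split=> //.
by apply: unifier_perm unE; rewrite perm_sym.
Qed.

Lemma invariant_init E : invariant (vars_sys E) [::] E.
Proof. by split. Qed.

End Correctness.

(** * Elementary unification *)

Section Elementary.
Variable S : signature.
Implicit Types (s t u m l r : term S) (sigma : subst S) (P Q U : seq nat).

Lemma members_vunion xs u :
  u \in members (vunion S xs) -> exists2 x, x \in xs & u = Var x.
Proof.
elim: xs => [|x [|y xs] IH] //.
  by rewrite inE => /eqP->; exists x; rewrite ?mem_head.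
rewrite [members _]/= inE -/(vunion S (y :: xs)) => /predU1P[->|/IH[z zxs ->]].
  by exists x; rewrite ?mem_head.
by exists z; rewrite // inE zxs orbT.
Qed.

Lemma atom_le_vunion sigma xs m : is_var m || is_app m ->
  aci_le m (tsubst sigma (vunion S xs)) ->
  exists2 x, x \in xs & exists2 m', m' \in members (sigma x) & aci1 m m'.
Proof.
move=> m_atom /(atom_le_prime m_atom)[m' /members_tsubst[u]].
by case/members_vunion=> x xs' -> m'x mm'; exists x => //; exists m'.
Qed.

(** [pickle] codes pairs injectively, and the offset [K] keeps the codes clear of all smaller
    variables. *)
Definition pair_name (K p q : nat) : nat := K + pickle (p, q).

(* The variable named by (p, q) stands for the intersection of the values of
   p and q, so p and q are both bound to unions involving it. *)
Definition pair_bind (K : nat) P Q (x : nat) : seq nat :=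
  (if x \in P then [seq pair_name K x q | q <- Q] else [::]) ++
  (if x \in Q then [seq pair_name K p x | p <- P] else [::]).

Lemma pair_bindP K P Q x a :
  a \in pair_bind K P Q x <->
  exists p q, [/\ p \in P, q \in Q, a = pair_name K p q & x = p \/ x = q].
Proof.
rewrite mem_cat; split=> [/orP[]|[p [q [pP qQ -> []->]]]].
- by case: ifP => // xP /mapP[q qQ ->]; exists x, q; split=> //; left.
- by case: ifP => // xQ /mapP[p pP ->]; exists p, x; split=> //; right.
- by rewrite pP map_f.
- by rewrite qQ (map_f (fun p => pair_name K p q)) ?orbT.
Qed.

(** Intersection of two finite sets of atoms. [aci_le] is a mere proposition, so the filter decides
    it classically. *)
Definition meet sigma (p q : nat) : term S :=
  bigU [seq m <- members (sigma p)
       | excluded_middle_informative (aci_le m (sigma q)) : bool].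

Lemma le_meet sigma p q t :
  aci_le (meet sigma p q) t <->
  (forall m, m \in members (sigma p) -> aci_le m (sigma q) -> aci_le m t).
Proof.
rewrite le_bigU_id; split=> [le m mp mq|le m].
  by apply: le; rewrite mem_filter mp andbT; case: excluded_middle_informative.
rewrite mem_filter => /andP[mq mp]; apply: le => //.
by move: mq; case: excluded_middle_informative.
Qed.

(** Both sides become the union of all pair variables. Conversely, for a unifier [sigma], send each
    pair variable to the meet of the two values: by primality a member of the value of some [p] in
    [P] is equal to a member of the value of some [q] in [Q], and hence appears in their meet. *)
Lemma pair_bind_mgu K P Q :
  mgu (fun x => vunion S (pair_bind K P Q x)) [:: (vunion S P, vunion S Q)].
Proof.
set theta := fun x => _.
have le_theta x t : aci_le (theta x) t <->
    (forall a, a \in pair_bind K P Q x -> aci_le (Var a) t).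
  by rewrite -{1}(tsubst_Var (theta x)) le_vunion.
split=> [e|sigma unS].
  rewrite inE => /eqP-> /=; apply: aci1_le_ext => t; rewrite !le_vunion.
  split=> le x xin; apply/le_theta => a /pair_bindP[p [q [pP qQ aE _]]].
    apply: (le_theta p t).1 (le p pP) _ _; apply/pair_bindP.
    by exists p, q; split=> //; left.
  apply: (le_theta q t).1 (le q qQ) _ _; apply/pair_bindP.
  by exists p, q; split=> //; right.
have {}unS := unS _ (mem_head _ _); rewrite /= in unS.
(* The default [Empty] is arbitrary: bindings contain pair variables only. *)
pose lambda a := if unpickle (a - K) is Some (p, q) then meet sigma p q else Empty.
have lambdaE p q : lambda (pair_name K p q) = meet sigma p q.
  by rewrite /lambda /pair_name addKn pickleK.
exists lambda => x; rewrite vars_sys1 mem_cat !vars_vunion /= => xPQ.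
apply: aci_le_anti; last first.
  apply/le_vunion => a /pair_bindP[p [q [_ _ -> xpq]]]; rewrite lambdaE.
  apply/le_meet => m mp mq; case: xpq => -> //.
  exact: mem_le.
apply/le_members => m mx.
have le_sigma ys y : y \in ys -> aci_le (sigma y) (tsubst sigma (vunion S ys)).
  by move: y; apply/le_vunion/aci_le_refl.
have le_bind p q : p \in P -> q \in Q -> x = p \/ x = q ->
    aci_le (meet sigma p q) (tsubst lambda (theta x)).
  move=> pP qQ xpq; rewrite -lambdaE.
  have/le_vunion := aci_le_refl (tsubst lambda (theta x)).
  by apply; apply/pair_bindP; exists p, q.
have m_atom := members_atom mx.
have [xP|xP] := boolP (x \in P).
  have [|q qQ [m' m'q mm']] := @atom_le_vunion sigma Q m m_atom.
    apply: aci_le_trans (aci1_le unS).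
    exact: aci_le_trans (mem_le mx) (le_sigma _ _ xP).
  apply: aci_le_trans (le_bind x q xP qQ (or_introl erefl)).
  have/le_meet := aci_le_refl (meet sigma x q); apply=> //.
  exact: aci_le_trans (aci1_le mm') (mem_le m'q).
have xQ : x \in Q by rewrite (negbTE xP) in xPQ.
have [|p pP [m' m'p mm']] := @atom_le_vunion sigma P m m_atom.
  apply: aci_le_trans (aci1_le (aci1_sym unS)).
  exact: aci_le_trans (mem_le mx) (le_sigma _ _ xQ).
apply: aci_le_trans (le_bind p x pP xQ (or_intror erefl)).
(* [meet] filters the members of its first argument, so [m] is exchanged for its equal in the value
   of [p]. *)
apply: aci_le_trans (aci1_le mm') _.
have/le_meet := aci_le_refl (meet sigma p x); apply=> //.
exact: aci_le_trans (aci1_le (aci1_sym mm')) (mem_le mx).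
Qed.

Lemma lt_fresh U x : (\max_(y <- U) y).+1 <= x -> x \notin U.
Proof.
by move=> lt_x; apply: contraL lt_x => xU; rewrite -leqNgt (leq_bigmax_seq _ xU).
Qed.

Lemma elementary_solution_exists U l r :
  exists NL NR bind, elementary_solution U l r NL NR bind.
Proof.
(* Three disjoint ranges: used variables below [K0], names from [K0] up to but excluding [K], pair
   variables from [K] on. *)
pose K0 := (\max_(y <- U) y).+1.
pose nL := size (app_members l); pose nR := size (app_members r).
pose K := K0 + (nL + nR).
exists (iota K0 nL), (iota (K0 + nL) nR).
exists (pair_bind K (iota K0 nL ++ var_members l)
                    (iota (K0 + nL) nR ++ var_members r)).
split; rewrite ?size_iota -?iotaD ?iota_uniq //.
- by move=> x; rewrite mem_iota => /andP[/lt_fresh].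
- move=> x a _ /pair_bindP[p [q [_ _ -> _]]]; rewrite mem_cat negb_or.
  have leK : K <= pair_name K p q by apply: leq_addr.
  rewrite mem_iota negb_and -!ltnNge ltnS leK orbT andbT.
  by apply: lt_fresh; apply: leq_trans leK; apply: leq_addr.
- exact: pair_bind_mgu.
Qed.

End Elementary.

(** * Completeness *)

Definition multiset_lt (m' m : seq nat) : Prop :=
  exists d k q,
    [/\ perm_eq m (d :: k), perm_eq m' (k ++ q) & all (fun i => i < d) q].

(** One entry is replaced by finitely many smaller ones. Induction on a strict bound, then on the
    number of copies of the largest allowed value [D], then on the accessibility of the part below
    [D]: replacing a copy of [D] lowers their number, and any other replacement keeps it and
    decreases the part below. *)
Lemma multiset_lt_wf : well_founded multiset_lt.
Proof.
suff acc D m : all (fun i => i < D) m -> Acc multiset_lt m.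
  move=> m; apply: (acc (\max_(i <- m) i).+1); apply/allP=> i im.
  by rewrite ltnS (leq_bigmax_seq _ im).
elim: D m => [|D IHD] m.
  case: m => [_|//]; constructor=> m' [d [k [q [/perm_size]]]] //.
have [c lt_c] := ubnP (count_mem D m); elim: c m lt_c => [m|c IHc m].
  by rewrite ltn0.
rewrite ltnS => le_c ltD.
have: Acc multiset_lt [seq i <- m | i < D] by apply: IHD; apply: filter_all.
move Ef: (filter _ _) => f acc_f.
elim: acc_f m Ef le_c ltD => {}f _ IHf m Ef le_c ltD.
constructor=> m' [d [k [q [pm pm' ltq]]]].
move: ltD; rewrite (perm_all _ pm) /= => /andP[led ltk].
have ltD' : all (fun i => i < D.+1) m'.
  rewrite (perm_all _ pm') all_cat ltk; apply/allP=> i iq /=.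
  exact: ltn_trans (allP ltq i iq) led.
have count_q : count_mem D q = 0.
  apply/eqP; rewrite -leqn0 leqNgt -has_count; apply/hasPn=> i iq /=.
  apply/eqP => iD; have:= allP ltq i iq; rewrite iD => /leq_trans/(_ led).
  by rewrite ltnn.
have count_m : count_mem D m = (d == D) + count_mem D k by rewrite (permP pm).
have count_m' : count_mem D m' = count_mem D k.
  by rewrite (permP pm') count_cat count_q addn0.
have [dD|dD] := eqVneq d D.
  by apply: IHc ltD'; rewrite count_m' -ltnS; move: le_c; rewrite count_m dD eqxx.
apply: (IHf [seq i <- m' | i < D]) => //; last first.
  by rewrite count_m'; move: le_c; rewrite count_m (negbTE dD).
have ltdD : d < D by rewrite ltn_neqAle dD.
exists d, [seq i <- k | i < D], [seq i <- q | i < D]; split.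
- by rewrite -Ef (perm_trans (perm_filter _ pm)) //= ltdD.
- by rewrite -filter_cat perm_filter.
- by rewrite all_filter; apply/allP=> i iq /=; rewrite (allP ltq) ?implybT.
Qed.

Section Completeness.
Variable S : signature.
Implicit Types (s t u v l r : term S) (sigma tau theta : subst S).
Implicit Types (E Es : system S) (e : term S * term S) (U xs : seq nat).

(** Both sides of an equation unified by [sigma] have the same weight, so the termination measure
    need only look at left-hand sides. *)
Definition weight sigma t : nat := depth (fun=> 0) (tsubst sigma t).

Lemma weight_aci1 sigma s t :
  aci1 (tsubst sigma s) (tsubst sigma t) -> weight sigma s = weight sigma t.
Proof. by move/depth_aci1/(_ (fun=> 0)). Qed.

Lemma weight_app_var sigma t x :
  is_app t -> x \in vars t -> weight sigma (Var x) < weight sigma t.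
Proof. by move=> t_app xt; rewrite /weight !depth_tsubst; apply: depth_app_var. Qed.

Lemma weight_args sigma s t :
  is_app s -> t \in args s -> weight sigma t < weight sigma s.
Proof.
case: s => // f ts _ /mapP[i _ ->]; rewrite /weight !depth_tsubst.
exact: depth_arg.
Qed.

Lemma is_app_tsubst sigma t : is_app t -> is_app (tsubst sigma t).
Proof. by case: t. Qed.

Lemma head_sym_tsubst sigma t : is_app t -> head_sym (tsubst sigma t) = head_sym t.
Proof. by case: t. Qed.

Lemma zip_index (A : seq (term S)) (N : seq nat) u x :
  uniq N -> (u, x) \in zip A N -> nth Empty A (index x N) = u.
Proof.
elim: A N => [|a A IH] [|n N] //= /andP[nN uN]; rewrite inE.
case/predU1P=> [[-> ->]|ux]; first by rewrite eqxx.
rewrite ifN; first exact: IH.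
by apply: contraNneq nN => ->; case: (mem_zip_pair ux).
Qed.

(** * The union step guided by a unifier *)

Section Guided.
Variables (U : seq nat) (l r : term S) (sigma : subst S).
Variables (NL NR : seq nat) (bind : nat -> seq nat).
Hypothesis lr_used : forall x, x \in vars l ++ vars r -> x \in U.
Hypothesis unify_lr : aci1 (tsubst sigma l) (tsubst sigma r).
Hypothesis es : elementary_solution U l r NL NR bind.

Local Notation names := (zip (app_members l ++ app_members r) (NL ++ NR)).
Local Notation E2 := (named_bindings l r NL NR bind).

(** The names are new, so [sigma] extends to them by the instances of the terms they stand for. The
    extension solves the variable-only equation and therefore factors through its most general
    unifier. *)
Lemma elementary_instance : exists lambda : subst S,
  (forall u x, (u, x) \in names ->
     aci1 (tsubst sigma u) (tsubst lambda (vunion S (bind x)))) /\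
  (forall x, x \in step_vars l r ->
     aci1 (sigma x) (tsubst lambda (vunion S (bind x)))).
Proof.
case: es => szL szR uq new _ [_ gen].
pose sigmaN x := if x \in NL ++ NR then
  tsubst sigma (nth Empty (app_members l ++ app_members r) (index x (NL ++ NR)))
  else sigma x.
have sigmaN_name u x : (u, x) \in names -> sigmaN x = tsubst sigma u.
  move=> ux; have [/= _ xN] := mem_zip_pair ux.
  by rewrite /sigmaN xN (zip_index uq ux).
have sigmaN_var x : x \in vars l ++ vars r -> sigmaN x = sigma x.
  by move=> /lr_used xU; rewrite /sigmaN ifN //; apply: contraL xU => /new.
have [|lambda gen_lambda] := gen sigmaN.
  move=> e; rewrite inE => /eqP-> /=; apply: aci1_le_ext => t.
  rewrite -(le_union_named (tau := sigma) _ szL); first last.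
  - move=> x /vars_var_members xl; rewrite sigmaN_var ?mem_cat ?xl //.
    exact: aci1_refl.
  - move=> u x ux; rewrite (sigmaN_name u x) ?mem_zip_cat ?ux //.
    exact: aci1_refl.
  rewrite -(le_union_named (tau := sigma) _ szR); first last.
  - move=> x /vars_var_members xr; rewrite sigmaN_var ?mem_cat ?xr ?orbT //.
    exact: aci1_refl.
  - move=> u x ux; rewrite (sigmaN_name u x) ?mem_zip_cat ?ux ?orbT //.
    exact: aci1_refl.
  exact: eq_aci_le unify_lr.
exists lambda; split=> [u x ux|x x_in].
  rewrite -(sigmaN_name u x ux); apply: gen_lambda.
  have [/= _ xN] := mem_zip_pair ux; rewrite vars_sys1 mem_cat !vars_vunion !mem_cat.
  by move: xN; rewrite mem_cat => /orP[]->; rewrite ?orbT.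
rewrite -(sigmaN_var x); last exact: vars_step_vars.
apply: gen_lambda; rewrite vars_sys1 mem_cat !vars_vunion !mem_cat.
by move: x_in; rewrite mem_step_vars => /orP[]->; rewrite ?orbT.
Qed.

Variable lambda : subst S.
Hypothesis lambda_name : forall u x, (u, x) \in names ->
  aci1 (tsubst sigma u) (tsubst lambda (vunion S (bind x))).
Hypothesis lambda_var : forall x, x \in step_vars l r ->
  aci1 (sigma x) (tsubst lambda (vunion S (bind x))).

(** The propagation dictated by [lambda]. Having no members is the decidable form of being equal to
    [Empty] modulo ACI1. *)
Definition guided_lam : subst S := fun a =>
  match [seq p <- E2 | a \in p.2] with
  | [::] => Var a
  | p :: _ => if members (lambda a) is [::] then Empty else p.1
  end.

Definition guided_ext : subst S := fun x => if x \in U then sigma x else lambda x.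

Local Notation lam := guided_lam.
Local Notation tau := guided_ext.

Lemma guided_propagation : propagation E2 lam.
Proof.
move=> a; rewrite /guided_lam; case: [seq p <- E2 | _] => // p _.
by case: (members _); [left | right].
Qed.

Lemma guided_ext_used t :
  (forall x, x \in vars t -> x \in U) -> tsubst tau t = tsubst sigma t.
Proof. by move=> tU; apply: tsubst_ext => x /tU; rewrite /guided_ext => ->. Qed.

Lemma guided_binding p : p \in E2 ->
  [/\ is_app p.1, tsubst tau p.1 = tsubst sigma p.1 &
      aci1 (tsubst sigma p.1) (tsubst lambda (vunion S p.2))].
Proof.
move=> pE; have [p_app pv] := named_binding_app pE; split=> //.
  by apply: guided_ext_used => x /pv/lr_used.
by have /named_bindingP[u [x [ux ->]]] := pE; apply: lambda_name.
Qed.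

Lemma le_guided_binding p a : p \in E2 -> a \in p.2 ->
  aci_le (lambda a) (tsubst tau p.1).
Proof.
move=> pE ap; have [_ -> eqp] := guided_binding pE.
apply: aci_le_trans (aci1_le (aci1_sym eqp)).
by have/le_vunion := aci_le_refl (tsubst lambda (vunion S p.2)); apply.
Qed.

(** If [a] occurs in a named binding, its value lies below the instance of an application, so by
    [le_atom] it is empty or that instance, as [guided_lam] chose. Otherwise [a] stays itself and,
    being fresh, is interpreted by [lambda]. *)
Lemma guided_lam_aci1 a x :
  x \in (NL ++ NR) ++ step_vars l r -> a \in bind x ->
  aci1 (tsubst tau (lam a)) (lambda a).
Proof.
move=> x_in ax; rewrite /guided_lam; case Ef: [seq p <- E2 | _] => [|p ps].
  rewrite /= /guided_ext ifN; first exact: aci1_refl.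
  have: a \notin U ++ NL ++ NR.
    apply: (es_fresh es) ax; move: x_in.
    by rewrite !mem_cat mem_step_vars => /orP[]/orP[]->; rewrite ?orbT.
  by rewrite mem_cat => /norP[].
have: p \in [seq p <- E2 | a \in p.2] by rewrite Ef mem_head.
rewrite mem_filter => /andP[ap pE]; have [p_app _ _] := guided_binding pE.
have [||a0] := le_atom (u := tsubst tau p.1) _ (le_guided_binding pE ap).
- by rewrite is_app_tsubst ?orbT.
- by move=> a0; rewrite a0; apply/aci1_sym/members0_aci1.
case Ea: (members _) => [|m ms]; last exact: aci1_sym.
exact/aci1_sym/members0_aci1.
Qed.

Lemma guided_rhs x : x \in (NL ++ NR) ++ step_vars l r ->
  aci1 (tsubst tau (rhs bind lam x)) (tsubst lambda (vunion S (bind x))).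
Proof.
move=> x_in; apply: aci1_le_ext => t; rewrite le_rhs le_vunion.
by split=> le a ax; apply/(eq_aci_le _ (guided_lam_aci1 x_in ax))/le.
Qed.

Lemma guided_fix x : x \in step_vars l r ->
  aci1 (tsubst tau (rhs bind lam x)) (tau x).
Proof.
move=> x_in; have xU := lr_used (vars_step_vars x_in).
rewrite {2}/guided_ext xU; apply: aci1_trans (aci1_sym (lambda_var x_in)).
by apply: guided_rhs; rewrite mem_cat x_in orbT.
Qed.

Lemma guided_propagated p u : p \in E2 -> u \in propagated lam p ->
  is_app u /\ aci1 (tsubst tau p.1) (tsubst tau u).
Proof.
move=> pE /mem_propagated[u0 [a ap ua]].
have u_app : is_app u.
  case: (propagationP a guided_propagation) => [[_ /(_ p pE)]|la|[q [qE _ la]]].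
  - by rewrite ap.
  - by rewrite ua la eqxx in u0.
  - by rewrite ua la; case: (named_binding_app qE).
split=> //; have [p_app _ _] := guided_binding pE.
have /named_bindingP[v [x [vx Ep]]] := pE; rewrite Ep /= in ap.
have x_in : x \in (NL ++ NR) ++ step_vars l r.
  by have [/= _ xN] := mem_zip_pair vx; rewrite mem_cat xN.
have le_u : aci_le (tsubst tau u) (tsubst tau p.1).
  apply/(eq_aci_le (s := tsubst tau u) (t := lambda a)).
    by rewrite ua; apply: guided_lam_aci1 ap.
  by apply: le_guided_binding => //; rewrite Ep.
have [||] := le_atom _ le_u; first by rewrite is_app_tsubst ?orbT.
  by case: (u) u_app.
exact: aci1_sym.
Qed.

(** Propagated terms are applications equal under the unifier to the left-hand side, hence share its
    head. If none were left, an application would lie below [Empty]. *)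
Lemma guided_accepted : accepted E2 lam.
Proof.
apply/allP=> p pE; have [p_app eqp eql] := guided_binding pE.
apply/andP; split; last first.
  apply/allP=> u up; have [u_app pu] := guided_propagated pE up.
  apply/eqP; rewrite -(head_sym_tsubst tau u_app) -(head_sym_tsubst tau p_app).
  by apply: app_aci1_heads; rewrite ?is_app_tsubst //; apply: aci1_sym.
rewrite lt0n size_eq0; apply/eqP => prop0.
have p_atom : is_var (tsubst tau p.1) || is_app (tsubst tau p.1).
  by rewrite is_app_tsubst ?orbT.
suff le0 : aci_le (tsubst tau p.1) Empty by apply: (members_nonempty p_atom le0).
have /named_bindingP[v [x [vx Ep]]] := pE.
have x_in : x \in (NL ++ NR) ++ step_vars l r.
  by have [/= _ xN] := mem_zip_pair vx; rewrite mem_cat xN.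
rewrite eqp; apply/(eq_aci_le _ eql); rewrite Ep /=.
apply/(eq_aci_le _ (guided_rhs x_in))/le_rhs => a ax.
have [->|a0] := eqVneq (lam a) Empty; first exact: aci_le0.
by have:= propagated_mem (p := p) _ a0; rewrite prop0 Ep => /(_ ax).
Qed.

Lemma guided_argument_system : unifier tau (argument_system E2 lam).
Proof.
move=> e /flatten_mapP[p pE /flatten_mapP[u up eu]].
have [p_app _ _] := guided_binding pE; have [u_app pu] := guided_propagated pE up.
apply: ((unifier_args tau p_app _).2 pu) eu.
rewrite -(head_sym_tsubst tau u_app) -(head_sym_tsubst tau p_app).
by apply: app_aci1_heads; rewrite ?is_app_tsubst.
Qed.

(** The left-hand side is an argument of a member of [l] or [r], and [l] and [r] have the same depth
    under [sigma]. *)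
Lemma guided_weight_argument e : e \in argument_system E2 lam ->
  weight tau e.1 < weight sigma l.
Proof.
move=> /flatten_mapP[p pE /flatten_mapP[u up /mem_zip_pair[ep _]]].
have [p_app eqp _] := guided_binding pE.
apply: leq_trans (weight_args tau p_app ep) _.
rewrite /weight eqp; apply: depth_le.
have le_mem t : p.1 \in app_members t -> aci_le (tsubst sigma p.1) (tsubst sigma t).
  rewrite mem_filter => /andP[_].
  by have/le_tsubst_members := aci_le_refl (tsubst sigma t); apply.
have [+ _] := mem_zip_pair pE; rewrite mem_cat => /orP[/le_mem//|/le_mem le_r].
exact: aci_le_trans le_r (aci1_le (aci1_sym unify_lr)).
Qed.

(** Bindings consist of fresh variables, so a step variable can enter the value of [x] only inside a
    propagated application, which makes it strictly shallower than [x]. *)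
Lemma guided_weight_depends x y :
  depends l r bind lam x y -> y \in step_vars l r ->
  weight tau (Var y) < weight tau (Var x).
Proof.
case/andP=> x_in /vars_tsubst[a]; rewrite vars_vunion => ax ya y_in.
have yU := lr_used (vars_step_vars y_in).
have <- : weight tau (rhs bind lam x) = weight tau (Var x).
  exact/weight_aci1/guided_fix.
have le_a : weight tau (lam a) <= weight tau (rhs bind lam x).
  apply: depth_le; have/le_rhs := aci_le_refl (tsubst tau (rhs bind lam x)).
  exact.
apply: leq_trans le_a; apply: weight_app_var (ya).
case: (propagationP a guided_propagation) ya => [[-> _]|->|[p [pE _ ->]]] //.
  rewrite inE => /eqP ya; have: a \notin U ++ NL ++ NR.
    apply: (es_fresh es) ax; move: x_in.
    by rewrite !mem_cat mem_step_vars => /orP[]->; rewrite ?orbT.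
  by rewrite mem_cat -ya yU.
by case: (named_binding_app pE).
Qed.

Lemma guided_acyclic : ~ cyclic l r bind lam.
Proof.
case=> x x_in cyc.
(* Recording that the source is a step variable lets two paths be joined at their common point. *)
have lt_path y z : clos_trans nat (fun x y => depends l r bind lam x y) y z ->
    y \in step_vars l r /\
    (z \in step_vars l r -> weight tau (Var z) < weight tau (Var y)).
  elim=> {y z} [y z yz|y z w _ [y_in zy] _ [z_in wz]].
    by split=> [|z_in]; [case/andP: yz | apply: guided_weight_depends].
  by split=> // /wz lt_wz; apply: ltn_trans lt_wz (zy z_in).
by have [_ /(_ x_in)] := lt_path _ _ cyc; rewrite ltnn.
Qed.

Lemma guided_order : exists xs, removal_order l r bind lam xs.
Proof.
pose ge x y := weight tau (Var y) <= weight tau (Var x).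
exists (sort ge (step_vars l r)); split; first by rewrite perm_sort.
have ge_trans : transitive ge by move=> y x z xy yz; apply: leq_trans yz xy.
have: pairwise ge (sort ge (step_vars l r)).
  rewrite -sorted_pairwise //; apply: sort_sorted => x y.
  exact: leq_total.
apply: (sub_in_pairwise (P := mem (step_vars l r))); last first.
  by apply/allP=> x; rewrite mem_sort.
(* If the value of the later [y] mentioned [x], then [y] would be strictly deeper than [x], against
   the decreasing sort. *)
move=> x y x_in _ le_yx; apply/negP => /guided_weight_depends/(_ x_in).
by rewrite ltnNge [_ <= _]le_yx.
Qed.

End Guided.

Lemma aci_step_complete U l r sigma :
    (forall x, x \in vars l ++ vars r -> x \in U) ->
    aci1 (tsubst sigma l) (tsubst sigma r) ->
  exists V E1 E2 rho tau,
    [/\ aci_step U l r (Some (V, E1, E2, rho)),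
        (forall x, x \in U -> tau x = sigma x),
        absorbs tau rho, unifier tau E1 /\ unifier tau E2 &
        forall e, e \in E2 -> weight tau e.1 < weight sigma l].
Proof.
move=> lr_used unify_lr.
have [NL [NR [bind es]]] := elementary_solution_exists U l r.
have [lambda [lname lvar]] := elementary_instance lr_used unify_lr es.
set lam := guided_lam l r NL NR bind lambda.
have acyc := guided_acyclic lr_used es lname lvar.
have [xs ord] := guided_order lr_used es lname lvar.
set tau := guided_ext U sigma lambda.
have fix_tau := guided_fix lr_used es lname lvar.
have abs : absorbs tau (composition bind lam xs).
  apply: absorbs_composition => x; case: (ord) => /perm_mem-> _.
  exact: fix_tau.
do 4!eexists; exists tau; split.
- apply: aci_done (es) _ _ (acyc) (ord); first exact: guided_propagation.
  exact: (guided_accepted lr_used es lname).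
- by move=> x xU; rewrite /tau /guided_ext xU.
- exact: abs.
- split.
    move=> _ /mapP[x x_in ->] /=; apply: aci1_trans (aci1_sym (fix_tau x x_in)) _.
    exact/aci1_sym/absorbs_tsubst.
  apply/unifier_subst_sys => //.
  exact: (guided_argument_system lr_used es lname).
- move=> _ /mapP[e eE ->] /=.
  rewrite [X in X < _](weight_aci1 (t := e.1)); last exact: absorbs_tsubst.
  exact: (guided_weight_argument lr_used unify_lr lname).
Qed.

(** * Construction of a terminating branch *)

Definition completable sigma (st : state S) : Prop :=
  exists Es tau, [/\ branch st Es,
    (forall x, x \in used st -> tau x = sigma x) & unifier tau Es].

Lemma completable_act U Es E e st sigma tau :
    act U Es E e (Some st) -> {subset U <= used st} ->
    (forall x, x \in U -> tau x = sigma x) ->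
  completable tau st -> completable sigma (State U Es (e :: E)).
Proof.
move=> step subU agree [Es' [tau' [br agree' un]]]; exists Es', tau'; split=> //.
  (* Selection is arbitrary, so the first equation may always be taken. *)
  exact: branch_step (step_select (E := [::]) step) br.
by move=> x xU; rewrite agree' ?agree //; apply: subU.
Qed.

Definition weights sigma E : seq nat := [seq weight sigma e.1 | e <- E].

Lemma weights_subst_sys sigma theta E :
  absorbs sigma theta -> weights sigma (subst_sys theta E) = weights sigma E.
Proof.
move=> abs; rewrite /weights -map_comp; apply: eq_map => e /=.
exact/weight_aci1/absorbs_tsubst.
Qed.

Lemma weights_agree sigma tau U E : {subset vars_sys E <= U} ->
  (forall x, x \in U -> tau x = sigma x) -> weights tau E = weights sigma E.
Proof.
move=> subE agree; apply/eq_in_map => e eE; rewrite /weight.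
congr depth; apply: tsubst_ext => x xe; apply: agree; apply: subE.
by apply/flatten_mapP; exists e; rewrite // mem_cat xe.
Qed.

Lemma unifier_agree sigma tau U E : {subset vars_sys E <= U} ->
  (forall x, x \in U -> tau x = sigma x) -> unifier sigma E -> unifier tau E.
Proof.
move=> subE agree un e eE.
have eqs t : {subset vars t <= vars e.1 ++ vars e.2} -> tsubst tau t = tsubst sigma t.
  move=> te; apply: tsubst_ext => x xt; apply: agree; apply: subE.
  by apply/flatten_mapP; exists e => //; apply: te.
by rewrite !eqs; [apply: un | |] => // x xe; rewrite mem_cat xe ?orbT.
Qed.

(** Orienting an equation and resolving a top occurrence do not decrease the multiset of weights.
    They are followed at once by the elimination they prepare, and the induction hypothesis is
    applied only after the weight of the selected equation has gone. *)
Lemma completable_of_unifier U Es E sigma :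
  invariant U Es E -> unifier sigma Es -> unifier sigma E ->
  completable sigma (State U Es E).
Proof.
move Em: (weights sigma E) => m; elim: m / (multiset_lt_wf m) => m _ IH
  in U Es E sigma Em *.
case: E Em => [|e E] Em inv unEs unE.
  by exists Es, sigma; split=> //; constructor.
set d := weight sigma e.1; set W := weights sigma E.
have {}IH U' Es' E' tau q :
    invariant U' Es' E' -> unifier tau Es' -> unifier tau E' ->
    perm_eq (weights tau E') (W ++ q) -> all (fun i => i < d) q ->
    completable tau (State U' Es' E').
  move=> inv' unEs' unE' pW ltq; apply: (IH (weights tau E')) => //.
  by exists d, W, q; rewrite -Em.
have perm_W : perm_eq W (W ++ [::]) by rewrite cats0.
have usedE : {subset vars_sys E <= U}.
  by move=> x xE; apply: (invariant_used inv); rewrite vars_sys_cons xE orbT.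
have used_e : {subset vars e.1 ++ vars e.2 <= U}.
  by move=> x xe; apply: (invariant_used inv); rewrite vars_sys_cons xe.
have usedEs : {subset vars_sys Es <= U}.
  by move=> x xEs; apply: (inv_used inv); rewrite vars_sys_cat mem_cat xEs.
have /unifier_cons[un_e un_E] := unE.
(* Stated for any [U1] and [tau], since a top occurrence reaches it with one more variable and an
   extended unifier. *)
have elim_case U1 tau x t : invariant U1 Es ((Var x, t) :: E) ->
    unifier tau Es -> unifier tau ((Var x, t) :: E) -> weights tau E = W ->
    x \notin vars t -> completable tau (State U1 Es ((Var x, t) :: E)).
  move=> inv1 unEs1 unE1 eqW xt; have step := act_eliminate U1 Es E xt.
  apply: (completable_act step) => //.
  have [inv2 _] := act_sound step inv1.
  have /unifier_cons[un1 unE2] := unE1; have abs := absorbs_subst1 un1.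
  apply: (IH _ _ _ _ [::]) => //.
  - apply/unifier_cons; split; last exact/unifier_subst_sys.
    exact: un1.
  - exact/unifier_subst_sys.
  - by rewrite weights_subst_sys // eqW.
have var_case x t : invariant U Es ((Var x, t) :: E) ->
    {subset vars (Var x : term S) ++ vars t <= U} ->
    aci1 (sigma x) (tsubst sigma t) ->
    completable sigma (State U Es ((Var x, t) :: E)).
  move=> inv1 used1 un1.
  have [xt|xt] := boolP (x \in vars t); last first.
    by apply: elim_case => //; apply/unifier_cons.
  have [t_var|t_nvar] := boolP (is_var t).
    case: t t_var inv1 used1 un1 xt => // y _ inv1 _ _; rewrite inE => /eqP xy.
    rewrite -{}xy in inv1 *; have step := act_trivial U Es E x.
    have [inv2 _] := act_sound step inv1.
    by apply: (completable_act step) => //; apply: (IH _ _ _ _ [::]).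
  (* Under a free symbol [x] would be strictly shallower than [t], although both have the same
     instance modulo ACI1. *)
  have x_app : x \notin flatten [seq vars u | u <- app_members t].
    apply/negP => /flatten_mapP[u ut xu]; have [u_app _] := app_memberP ut.
    have: weight sigma u <= weight sigma t.
      apply: depth_le; move: ut; rewrite mem_filter => /andP[_].
      by have/le_tsubst_members := aci_le_refl (tsubst sigma t); apply.
    rewrite -(weight_aci1 (s := Var x) un1) leqNgt.
    by rewrite (weight_app_var sigma u_app xu).
  have x_mem : x \in var_members t.
    have /vars_members[u ut xu] := xt; rewrite mem_var_members.
    have /orP[u_var|u_app] := members_atom ut.
      by case: u u_var ut xu => // y _ ut; rewrite inE => /eqP->.
    case/negP: x_app; apply/flatten_mapP; exists u => //.
    by rewrite mem_filter u_app.
  pose n := (\max_(y <- U) y).+1; have nU : n \notin U by apply: lt_fresh.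
  have xU : x \in U by apply: used1; rewrite mem_head.
  have step := act_top_occurs Es E t_nvar x_mem x_app nU.
  have [inv2 _] := act_sound step inv1.
  (* Giving [n] the whole value of [x] solves the new equation, because the remaining members of [t]
     lie below that value. *)
  pose tau y := if y == n then sigma x else sigma y.
  have agree y : y \in U -> tau y = sigma y.
    by rewrite /tau; case: eqP => // -> /(negP nU).
  apply: (completable_act step _ agree); first by move=> y yU; rewrite inE yU orbT.
  have vars_rest y : y \in vars (bigU [seq u <- members t | u != Var x]) ->
      y != x /\ y \in vars t.
    case/vars_bigU=> u; rewrite mem_filter => /andP[ux ut] yu.
    split; last by apply/vars_members; exists u.
    apply: contraTneq yu => ->; have /orP[u_var|u_app] := members_atom ut.
      case: u u_var ux ut => // z _ zx _; rewrite inE.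
      by apply: contraNneq zx => ->.
    apply: contra x_app => xu; apply/flatten_mapP; exists u => //.
    by rewrite mem_filter u_app.
  apply: elim_case => //.
  - exact: unifier_agree usedEs agree unEs.
  - apply/unifier_cons; split; last exact: unifier_agree usedE agree un_E.
    have tau_n : tau n = sigma x by rewrite /tau eqxx.
    rewrite /= tau_n agree // (tsubst_ext (tau := sigma)); last first.
      by move=> y /vars_rest[_ yt]; apply/agree/used1; rewrite mem_cat yt orbT.
    apply/aci1_sym/le_bigU => u; rewrite mem_filter => /andP[_ ut].
    apply: aci_le_trans (aci1_le (aci1_sym un1)).
    by have/le_tsubst_members := aci_le_refl (tsubst sigma t); apply.
  - exact: weights_agree usedE agree.
  - rewrite /= mem_cat inE negb_or; apply/andP; split.
      by apply/negP => /vars_rest[]; rewrite eqxx.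
    by apply: contraNneq nU => <-.
case: e => s t /= in d inv unE Em un_e used_e IH *.
have [s_var|s_nvar] := boolP (is_var s).
  by case: s s_var => // x _ in d inv unE Em un_e used_e IH *; apply: var_case.
have [t_var|t_nvar] := boolP (is_var t).
  case: t t_var => // x _ in d inv unE Em un_e used_e IH *.
  have step := act_orient U Es E x s_nvar.
  have [inv2 _] := act_sound step inv.
  apply: (completable_act step) => //; apply: var_case => //.
    by move=> y; rewrite mem_cat orbC -mem_cat; apply: used_e.
  exact: aci1_sym.
have [un_st|/norP[s_nun t_nun]] := boolP (is_union s || is_union t).
  have [V [E1 [E2 [rho [tau]]]]] := aci_step_complete used_e un_e.
  case=> astep agree abs [un1 un2] lt_d.
  have step := act_union Es E s_nvar t_nvar un_st astep.
  have [inv2 _] := act_sound step inv.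
  apply: (completable_act step _ agree).
    by move=> y yU; rewrite mem_cat yU orbT.
  apply: (IH _ _ _ _ (weights tau E2)) => //.
  - apply/unifier_cat; split=> //; apply/unifier_subst_sys => //.
    exact: unifier_agree usedEs agree unEs.
  - apply/unifier_cat; split=> //; apply/unifier_subst_sys => //.
    exact: unifier_agree usedE agree un_E.
  - by rewrite /weights map_cat -!/(weights _ _) weights_subst_sys //
      (weights_agree usedE agree).
  - by apply/allP=> _ /mapP[e' e'E ->]; apply: lt_d.
have decompose : head_sym s = head_sym t ->
    unifier sigma (zip (args s) (args t)) ->
    all (fun i => i < d) (weights sigma (zip (args s) (args t))) ->
    completable sigma (State U Es ((s, t) :: E)).
  move=> heads unA ltA.
  have step := act_decompose U Es E s_nvar t_nvar s_nun t_nun heads.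
  have [inv2 _] := act_sound step inv.
  apply: (completable_act step) => //; apply: IH ltA => //.
    exact/unifier_cat.
  by rewrite /weights map_cat perm_catC.
(* If [s] is no application it is [Empty]; so is [t], since no application equals [Empty], and the
   decomposition produces no equation. *)
have [s_app|s_napp] := boolP (is_app s); last first.
  have s0 : s = Empty by case: (s) s_nvar s_nun s_napp.
  have t0 : t = Empty.
    case: t t_nvar t_nun un_e {inv unE Em used_e decompose IH} => // f ts _ _.
    rewrite s0 => /aci1_sym/aci1_le.
    by case/(@members_nonempty _ Empty (tsubst sigma (App f ts)) isT).
  by apply: decompose; rewrite s0 t0.
have t_app : is_app t.
  case: t t_nvar t_nun un_e {inv unE Em used_e decompose IH} => // _ _.
  move/aci1_le; have sA := is_app_tsubst sigma s_app.
  by case/(@members_nonempty _ Empty (tsubst sigma s)); rewrite ?sA ?orbT.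
have heads : head_sym s = head_sym t.
  rewrite -(head_sym_tsubst sigma s_app) -(head_sym_tsubst sigma t_app).
  by apply: app_aci1_heads; rewrite ?is_app_tsubst.
apply: decompose => //; first exact/unifier_args.
apply/allP=> _ /mapP[e' /mem_zip_pair[e's _] ->].
exact: weight_args.
Qed.

(** Every binding of [subst_of Es] is an equation solved by [tau], so [tau] is itself the witness
    that [subst_of Es] is more general. *)
Lemma absorbs_subst_of tau Es : unifier tau Es -> absorbs tau (subst_of Es).
Proof.
elim: Es => [|e Es IH] un x; first exact: aci1_refl.
have /unifier_cons[un1 /IH abs] := un; rewrite /=.
by case: eqP un1 => [-> /aci1_sym|_ _].
Qed.

Lemma completable_more_general E sigma :
    completable sigma (State (vars_sys E) [::] E) ->
  exists2 Es, general_aci E Es & more_general (vars_sys E) (subst_of Es) sigma.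
Proof.
case=> Es [tau [br agree un]]; exists Es => //; exists tau => x xE.
by rewrite -agree //; apply/aci1_sym/absorbs_subst_of.
Qed.

End Completeness.

Theorem theorem8p5 (S : signature) (E : system S) :
  (forall Es : system S,
      general_aci E Es -> solved_form Es /\ unifier (subst_of Es) E) /\
  (forall sigma : subst S,
      unifier sigma E ->
      exists2 Es : system S,
        general_aci E Es & more_general (vars_sys E) (subst_of Es) sigma).
Proof.
split=> [Es br|sigma un].
  have [[U inv] un] := branch_sound br (invariant_init E).
  split; first exact: invariant_solved_form inv.
  by have [_] := un _ (invariant_unifier inv).
apply: completable_more_general.
by apply: completable_of_unifier un; first exact: invariant_init.
Qed.
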